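(* Let $N\ge 2$, let $\Omega\subset\mathbb{R}^N$ be a bounded convex domain of the form $$\Omega=\bigcap_{(y,O)\in\mathcal{C}}O\,Q(y)$$ for some subset $\mathcal{C}$ of $Y\times\mathcal{O}$, where $Y\subset\mathbb{R}^N$ and $\mathcal{O}$ is the set of $N\times N$ orthogonal matrices, and let $f$ be a continuous and bounded function in $\Omega$. If there exist $\alpha>0$ and $\beta\in(0,1]$ such that $$f(x)\ge-\alpha\left(\inf_{(y,O)\in\mathcal{C}}\phi_{y,O}(x)\right)^\beta\qquad\forall x\in\Omega,$$ then there exists a unique viscosity solution $u$ of $$\begin{cases}\mathcal{P}^+_1(D^2u)=f(x)&\text{in }\Omega,\\ u=0&\text{on }\partial\Omega.\end{cases}$$ Moreover $u\in C^{0,\frac{\beta}{N}}(\overline\Omega)$ and the H\''older norm of $u$ depends only on $\alpha$, $\beta$, $N$ and the $L^\infty$ norms of $u$ and $f$.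
   Context: For a symmetric real $N\times N$ matrix $X$, $\mathcal{P}^+_1(X)=\lambda_N(X)$ denotes its largest eigenvalue. For $y\in\mathbb{R}^N$, $Q(y)=\prod_{i=1}^N\left(y_i-\frac{\pi}{2},y_i+\frac{\pi}{2}\right)$ is the open cube with center $y$ and side length $\pi$, and for an orthogonal matrix $O$, $O\,Q(y)=\{Ox : x\in Q(y)\}$. The function $\phi(x)=\prod_{i=1}^N\sqrt[N]{\cos x_i}$ is defined on the closed cube $\left[-\frac{\pi}{2},\frac{\pi}{2}\right]^N$, and $\phi_{y,O}(x)=\phi(O^{\mathsf{T}}x-y)$ for $x\in\overline{O\,Q(y)}$. (By convexity, every bounded convex domain can, after rescaling, be written as such an intersection of cubes of side length $\pi$.) *)

(* Defs.v *)
From HB Require Import structures.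
From mathcomp Require Import all_boot all_order all_algebra.
From mathcomp Require Import all_classical all_reals all_analysis.
Import Order.TTheory GRing.Theory Num.Theory.
Import numFieldNormedType.Exports.

Set Implicit Arguments.
Unset Strict Implicit.
Unset Printing Implicit Defensive.

Local Open Scope classical_set_scope.
Local Open Scope ring_scope.

(* MathComp-Analysis, over an arbitrary R : realType; points of R^N are column
   vectors.  The canonical norm of 'cV[R]_N is the sup norm; it is used only
   for topology and boundedness.  Hölder quotients use [enorm]. *)

Section Geometry.
Variables (R : realType) (N : nat).
Implicit Types (x y : 'cV[R]_N) (O : 'M[R]_N).

Definition enorm x : R := Num.sqrt (\sum_(i < N) x i ord0 ^+ 2).

Definition is_domain (A : set 'cV[R]_N) : Prop :=
  [/\ A !=set0, open A & connected A].

Definition boundary (A : set 'cV[R]_N) : set 'cV[R]_N :=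
  closure A `\` interior A.

Definition orthogonal_matrices : set 'M[R]_N := [set O | O^T *m O = 1%:M].

Definition cube y : set 'cV[R]_N :=
  [set x | forall i : 'I_N,
    y i ord0 - pi / 2%:R < x i ord0 /\ x i ord0 < y i ord0 + pi / 2%:R].

Definition rot_cube (c : 'cV[R]_N * 'M[R]_N) : set 'cV[R]_N :=
  [set c.2 *m x | x in cube c.1].

(* Meant on the closed cube centered at 0, where every cosine is nonnegative,
   so that the real power with exponent 1/N is the N-th root (and 0 at 0). *)
Definition phi x : R := \prod_(i < N) (cos (x i ord0) `^ (N%:R^-1)).

Definition rot_phi (c : 'cV[R]_N * 'M[R]_N) x : R := phi (c.2^T *m x - c.1).

Definition inf_rot_phi (C : set ('cV[R]_N * 'M[R]_N)) x : R :=
  inf [set rot_phi c x | c in C].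

End Geometry.

Section Calculus.
Variables (R : realType) (N : nat).
Implicit Types (A : set 'cV[R]_N) (g : 'cV[R]_N -> R).

Definition partial (i : 'I_N) g : 'cV[R]_N -> R :=
  fun x => 'D_(delta_mx i ord0) g x.

Definition C0_on A g : Prop := forall x, A x -> {for x, continuous g}.

Definition C1_on A g : Prop :=
  C0_on A g /\
  forall i : 'I_N, (forall x, A x -> derivable g x (delta_mx i ord0)) /\
                   C0_on A (partial i g).

Definition C2_on A g : Prop :=
  C1_on A g /\ forall i : 'I_N, C1_on A (partial i g).

Definition hessian g (x : 'cV[R]_N) : 'M[R]_N :=
  \matrix_(i, j) partial j (partial i g) x.

(* For X symmetric and N >= 1 this set is finite and nonempty, so its supremum
   is its maximum lambda_N(X). *)
Definition P1plus (X : 'M[R]_N) : R := sup [set a : R | eigenvalue X a].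

End Calculus.

Section Viscosity.
Variables (R : realType) (N : nat).
Implicit Types (A : set 'cV[R]_N) (f u g : 'cV[R]_N -> R).

Definition is_local_max g (x : 'cV[R]_N) : Prop :=
  \forall z \near x, g z <= g x.

Definition is_local_min g (x : 'cV[R]_N) : Prop :=
  \forall z \near x, g x <= g z.

(* Continuous viscosity solutions of P1plus (D^2 u) = f in the open set A. *)
Definition viscosity_solution A f u : Prop :=
  [/\ C0_on A u,
      (forall psi x, C2_on A psi -> A x ->
         is_local_max (fun z => u z - psi z) x ->
         f x <= P1plus (hessian psi x)) &
      (forall psi x, C2_on A psi -> A x ->
         is_local_min (fun z => u z - psi z) x ->
         P1plus (hessian psi x) <= f x)].

(* Boundary values are attained continuously; values of u outside the closure
   of A are irrelevant. *)
Definition dirichlet_solution A f u : Prop :=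
  [/\ {within closure A, continuous u},
      viscosity_solution A f u &
      forall x, boundary A x -> u x = 0].

End Viscosity.

Section Norms.
Variables (R : realType) (N : nat).
Implicit Types (A : set 'cV[R]_N) (u : 'cV[R]_N -> R).
Local Open Scope ereal_scope.

Definition sup_norm A u : \bar R := ereal_sup [set `|u x|%:E | x in A].

Definition holder_seminorm (gamma : R) A u : \bar R :=
  ereal_sup [set (`|u p.1 - u p.2| / enorm (p.1 - p.2) `^ gamma)%R%:E |
             p in [set p | [/\ A p.1, A p.2 & p.1 <> p.2]]].

Definition holder_norm (gamma : R) A u : \bar R :=
  sup_norm A u + holder_seminorm gamma A u.

Definition holder_space (gamma : R) A : set ('cV[R]_N -> R) :=
  [set u | holder_norm gamma A u < +oo].

End Norms.

(* Main.v *)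
(** The inequality [lambda_N(D^2 w) <= f] says exactly that [w'' <= f] along
every line, i.e. that on every chord where [f <= m] the function [w] lies above
the parabola [q'' = m] with the same end values.  This form is linear in [w]
and stable under infima, so the solution [u] is the least function satisfying
it and vanishing outside the domain.  The products of powers of cosines attached to the
cubes of [C] belong to this class, whence [0 = u] on the boundary and
[u <= B |x - x0|^gamma] for [x0] outside the domain, with [gamma = beta / N];
extending the chord [x y] beyond [x] until it leaves the domain, where [u = 0],
turns this one-sided bound into a Hölder estimate on the whole space.  Perron's
bump argument shows that [u] is also a subsolution.

For uniqueness, a solution [v] belongs to the class, so [u <= v].  Conversely,
since the class is defined by linear inequalities along lines, averaging [u]
preserves them up to the oscillation of [f]; hence iterated Steklov averages of [u] are
smooth strict supersolutions (after adding a small quadratic) and can be used as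
test functions for the subsolution [v], with no need for Ishii's lemma. *)

Require Import Defs.
From mathcomp Require Import all_boot all_order all_algebra.
From mathcomp Require Import all_classical all_reals all_analysis.
From mathcomp Require Import ring lra.
Import Order.TTheory GRing.Theory Num.Theory.
Import numFieldNormedType.Exports.

Set Implicit Arguments.
Unset Strict Implicit.
Unset Printing Implicit Defensive.

Local Open Scope classical_set_scope.
Local Open Scope ring_scope.

Section EpsilonDelta.
Variables (R : realType) (V : normedModType R).

Lemma cont_epsP (g : V -> R) x : {for x, continuous g} <->
  forall e, 0 < e -> exists2 r, 0 < r &
    forall z, `|z - x| < r -> `|g z - g x| < e.
Proof.
split.
  move=> /cvgrPdist_lt gx e /gx; rewrite -nbhs_nearE => /nbhs_normP[r /= r0 H].
  exists r => // z zx; rewrite distrC; apply: H => /=.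
  by rewrite /ball_/= distrC.
move=> H; apply/cvgrPdist_lt => e /H[r r0 {}H].
rewrite -nbhs_nearE; apply/nbhs_normP; exists r => // z /= zx.
by rewrite distrC; apply: H; rewrite distrC.
Qed.

Lemma is_derive_epsP (g : V -> R) x v l : is_derive x v g l <->
  forall e, 0 < e -> exists2 r, 0 < r &
    forall h, `|h| < r -> `|g (x + h *: v) - g x - h * l| <= e * `|h|.
Proof.
have alg (a b c h : R) : h != 0 -> (h^-1 * (a - b) - c) * h = a - b - h * c.
  by move=> h0; field.
have eqq h : h != 0 -> `|l - h^-1 *: ((g \o shift x) (h *: v) - g x)| * `|h| =
    `|g (x + h *: v) - g x - h * l|.
  move=> h0; rewrite distrC -normrM /shift /= [h *: v + x]addrC.
  by congr `| _ |; exact: alg.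
have Hc : is_derive x v g l <->
    h^-1 *: ((g \o shift x) (h *: v) - g x) @[h --> 0^'] --> l.
  split=> [[dg <-]//|H].
  have dg : derivable g x v by apply: cvgP H.
  by apply: DeriveDef => //; apply: cvg_lim H.
rewrite Hc; split.
  move=> /cvgrPdist_lt gx e /gx; rewrite -nbhs_nearE => /nbhs_normP[r /= r0 H].
  exists r => // h hr; have [->|h0] := eqVneq h 0.
    by rewrite scale0r addr0 mul0r subrr subr0 normr0 mulr0.
  rewrite -eqq//; apply: ler_wpM2r => //; apply: ltW; apply: H => //.
  by rewrite /ball_/= sub0r normrN.
move=> H; apply/cvgrPdist_le => e /H[r r0 {}H].
rewrite -nbhs_nearE; apply/nbhs_normP; exists r => // h /= hr h0.
have := H h; rewrite -eqq// ler_pM2r ?normr_gt0//; apply.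
by move: hr; rewrite /ball_/= sub0r normrN.
Qed.

Lemma cont_cst (c : R) x : {for x, continuous (fun _ : V => c)}.
Proof. exact: cvg_cst. Qed.

Lemma cont_add (f g : V -> R) x : {for x, continuous f} ->
  {for x, continuous g} -> {for x, continuous (fun z => f z + g z)}.
Proof. by move=> cf cg; apply: cvgD. Qed.

Lemma cont_sub (f g : V -> R) x : {for x, continuous f} ->
  {for x, continuous g} -> {for x, continuous (fun z => f z - g z)}.
Proof. by move=> cf cg; apply: cvgB. Qed.

Lemma cont_mul (f g : V -> R) x : {for x, continuous f} ->
  {for x, continuous g} -> {for x, continuous (fun z => f z * g z)}.
Proof. by move=> cf cg; apply: cvgM. Qed.

Lemma cont_min (f g : V -> R) x : {for x, continuous f} ->
  {for x, continuous g} -> {for x, continuous (fun z => Num.min (f z) (g z))}.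
Proof.
move=> cf cg.
have E a b : Num.min a b = (a + b - `|a - b|) / 2 :> R.
  by case: (leP a b) => ab; [rewrite ler0_norm ?subr_le0//|rewrite gtr0_norm ?subr_gt0//]; field.
rewrite (_ : (fun z => _) = fun z => (f z + g z - `|f z - g z|) / 2); last first.
  by apply/funext => z; rewrite E.
apply: cont_mul; last exact: cont_cst.
apply: cont_sub; first exact: cont_add.
by apply: cvg_norm; apply: cont_sub.
Qed.

Lemma cont_sum (I : Type) (r : seq I) (F : I -> V -> R) x :
  (forall i, {for x, continuous (F i)}) ->
  {for x, continuous (fun z => \sum_(i <- r) F i z)}.
Proof.
move=> cF; elim: r => [|i r IH].
  rewrite (_ : (fun z => _) = cst 0); first exact: cvg_cst.
  by apply/funext => z; rewrite big_nil.
rewrite (_ : (fun z => _) = fun z => F i z + \sum_(j <- r) F j z).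
  by apply: cvgD; [exact: cF|exact: IH].
by apply/funext => z; rewrite big_cons.
Qed.

Lemma cont_cV n (f : V -> 'cV[R]_n) x :
  (forall i, {for x, continuous (fun z => f z i ord0)}) -> {for x, continuous f}.
Proof.
move=> cf t [P PX Pt].
have : \forall z \near x, forall i : 'I_n, P i ord0 (f z i ord0).
  by apply: filter_forall => i; apply: (cf i); exact: PX.
by apply: filterS => z H; apply: Pt => i j; rewrite ord1; exact: H.
Qed.

Lemma cont_eps_fin (I : finType) (g : I -> V -> R) x :
  (forall i, {for x, continuous (g i)}) -> forall e, 0 < e ->
  exists2 r, 0 < r & forall i z, `|z - x| < r -> `|g i z - g i x| < e.
Proof.
move=> cg e e0.
have : \forall z \near x, forall i, `|g i z - g i x| < e.
  apply: filter_forall => i; have /cvgrPdist_lt /(_ e e0) := cg i.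
  by apply: filterS => z; rewrite distrC.
rewrite -nbhs_nearE => /nbhs_normP[r /= r0 H]; exists r => // i z zx.
by apply: H; rewrite /ball_/= distrC.
Qed.

Lemma open_norm (A : set V) x : open A -> A x ->
  exists2 r, 0 < r & forall z, `|z - x| < r -> A z.
Proof.
move=> oA Ax; have /nbhs_normP[r /= r0 H] := open_nbhs_nbhs (conj oA Ax).
by exists r => // z zx; apply: H; rewrite /ball_/= distrC.
Qed.

Lemma norm_near (P : V -> Prop) x : (\forall z \near x, P z) <->
  exists2 r, 0 < r & forall z, `|z - x| < r -> P z.
Proof.
rewrite -nbhs_nearE; split=> [/nbhs_normP[r /= r0 H]|[r r0 H]].
  by exists r => // z zx; apply: H; rewrite /ball_/= distrC.
by apply/nbhs_normP; exists r => // z /=; rewrite /ball_/= distrC => /H.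
Qed.

End EpsilonDelta.

Lemma is_derive_line (R : realType) (V : normedModType R) (g : V -> R) (x v : V) (s l : R) :
  is_derive s (1 : R) (fun t : R => g (x + t *: v)) l <->
  is_derive (x + s *: v) v g l.
Proof.
rewrite !is_derive_epsP.
by split=> H e e0; have [r r0 K] := H e e0; exists r => // h hr; have := K h hr;
  rewrite /= scalerDl addrA [h *: 1]mulr1.
Qed.

Section Vectors.
Variables (R : realType) (N : nat).
Implicit Types (x y z d : 'cV[R]_N) (A : set 'cV[R]_N).

Definition dot x y : R := \sum_(i < N) x i ord0 * y i ord0.
Definition nsq x : R := \sum_(i < N) x i ord0 ^+ 2.
Definition sdiff (w : 'cV[R]_N -> R) x d : R := w (x + d) + w (x - d) - 2 * w x.
Definition unitv (i : 'I_N) : 'cV[R]_N := delta_mx i ord0.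

Lemma nsqE x : nsq x = dot x x.
Proof. by apply: eq_bigr => i _; rewrite expr2. Qed.

Lemma nsq_ge0 x : 0 <= nsq x.
Proof. by apply: sumr_ge0 => i _; rewrite sqr_ge0. Qed.

Lemma nsqZ t x : nsq (t *: x) = t ^+ 2 * nsq x.
Proof. by rewrite mulr_sumr; apply: eq_bigr => i _; rewrite mxE exprMn. Qed.

Lemma nsqN x : nsq (- x) = nsq x.
Proof. by apply: eq_bigr => i _; rewrite mxE sqrrN. Qed.

Lemma nsq_eq0 x : nsq x = 0 -> x = 0.
Proof.
move=> /eqP; rewrite psumr_eq0 => [/allP H|i _]; last exact: sqr_ge0.
apply/matrixP => i j; rewrite ord1 mxE; apply/eqP; rewrite -sqrf_eq0.
by apply: H; rewrite mem_index_enum.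
Qed.

Lemma nsq_gt0 x : x != 0 -> 0 < nsq x.
Proof. by move=> x0; rewrite lt_neqAle nsq_ge0 andbT eq_sym; apply: contra_neq x0; exact: nsq_eq0. Qed.

Lemma dotC x y : dot x y = dot y x.
Proof. by apply: eq_bigr => i _; rewrite mulrC. Qed.

Lemma dotDl x y z : dot (x + y) z = dot x z + dot y z.
Proof. by rewrite -big_split; apply: eq_bigr => i _; rewrite mxE mulrDl. Qed.

Lemma dotDr x y z : dot z (x + y) = dot z x + dot z y.
Proof. by rewrite dotC dotDl !(dotC z). Qed.

Lemma dotZl t x z : dot (t *: x) z = t * dot x z.
Proof. by rewrite mulr_sumr; apply: eq_bigr => i _; rewrite mxE mulrA. Qed.

Lemma dotZr t x z : dot z (t *: x) = t * dot z x.
Proof. by rewrite dotC dotZl dotC. Qed.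

Lemma dotNl x z : dot (- x) z = - dot x z.
Proof. by rewrite -scaleN1r dotZl mulN1r. Qed.

Lemma dotNr x z : dot z (- x) = - dot z x.
Proof. by rewrite dotC dotNl dotC. Qed.

Definition dotE := (dotDl, dotDr, dotNl, dotNr, dotZl, dotZr).

Lemma coord_le_norm x i : `|x i ord0| <= `|x|.
Proof.
rewrite [leRHS]/Num.norm/= mx_normrE; apply/bigmax_geP; right => /=.
by exists (i, ord0).
Qed.

Lemma norm_le_coord x c : 0 <= c -> (forall i, `|x i ord0| <= c) -> `|x| <= c.
Proof.
move=> c0 H; rewrite /Num.norm /= mx_normrE; apply/bigmax_leP; split=> // -[i j] _.
by rewrite ord1; exact: H.
Qed.

Lemma coord_le_enorm x i : `|x i ord0| <= enorm x.
Proof.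
rewrite -sqrtr_sqr ler_wsqrtr// (bigD1 i)//= lerDl.
by apply: sumr_ge0 => j _; exact: sqr_ge0.
Qed.

Lemma enorm_ge0 x : 0 <= enorm x. Proof. exact: sqrtr_ge0. Qed.

Lemma norm_le_enorm x : `|x| <= enorm x.
Proof. by apply: norm_le_coord => [|i]; [exact: enorm_ge0|exact: coord_le_enorm]. Qed.

Lemma sqr_enorm x : enorm x ^+ 2 = nsq x.
Proof. by rewrite sqr_sqrtr//; exact: nsq_ge0. Qed.

Lemma nsq_le_norm x : nsq x <= N%:R * `|x| ^+ 2.
Proof.
rewrite -[X in X%:R](card_ord N) mulr_natl -sumr_const ler_sum// => i _.
by rewrite -real_normK ?num_real// ler_sqr ?nnegrE// coord_le_norm.
Qed.

Lemma enorm_le_norm x : enorm x <= N%:R * `|x|.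
Proof.
rewrite -(@ler_pXn2r _ 2)// ?nnegrE ?enorm_ge0 ?mulr_ge0// sqr_enorm.
apply: le_trans (nsq_le_norm x) _; rewrite exprMn ler_wpM2r ?sqr_ge0//.
by rewrite -natrX ler_nat; case: (N) => // n; rewrite expnS leq_pmulr.
Qed.

Lemma enormZ t x : enorm (t *: x) = `|t| * enorm x.
Proof. by rewrite /enorm -/(nsq _) nsqZ sqrtrM ?sqr_ge0// sqrtr_sqr. Qed.

Lemma enormN x : enorm (- x) = enorm x.
Proof. by rewrite /enorm -/(nsq _) nsqN. Qed.

Lemma enorm_gt0 x : x != 0 -> 0 < enorm x.
Proof. by move=> x0; rewrite sqrtr_gt0; exact: nsq_gt0. Qed.

Lemma normr_unitv i : `|unitv i| <= 1.
Proof. by apply: norm_le_coord => // j; rewrite mxE; case: eqP => _; rewrite /= ?normr1// normr0. Qed.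

Lemma compact_cV A : bounded_set A -> closed A -> compact A.
Proof.
move=> bA cA.
have ct m n : continuous (@trmx R m n).
  move=> X t [P PX Pt]; exists (fun i j => P j i) => [i j|Y HY].
    by have := PX j i; rewrite mxE.
  by apply: Pt => i j; rewrite mxE; exact: HY.
have -> : A = trmx @` (trmx @^-1` A : set 'rV[R]_N).
  apply/seteqP; split=> [x Ax|_ [y Ay <-]//].
  by exists x^T => /=; rewrite trmxK.
apply: continuous_compact; first by apply: continuous_subspaceT; exact: ct.
apply: bounded_closed_compact; last by apply: preimage_closed => // x _; exact: ct.
move: bA => [M [Mr H]]; exists M; split=> // M' /H{}H y /= Ay.
have := H _ Ay; congr (_ <= _).
rewrite /Num.norm /= !mx_normrE; apply/eqP; rewrite eq_le; apply/andP; split;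
  apply/bigmax_leP; split=> //; try (by apply/bigmax_geP; left);
  move=> [i j] _; apply/bigmax_geP; right; exists (j, i) => //=; rewrite mxE//.
Qed.

Lemma compact_closed_ball x r : compact [set z : 'cV[R]_N | `|z - x| <= r].
Proof.
apply: compact_cV.
  exists (`|x| + r); split; first exact: num_real.
  move=> M' hM z /= zx; apply: ltW; apply: le_lt_trans hM.
  by rewrite -[z](subrK x) (le_trans (ler_normD _ _))// addrC lerD2l.
rewrite (_ : [set z | _] = closed_ball_ Num.norm x r); first exact: closed_closed_ball_.
by apply/seteqP; split=> z /=; rewrite distrC.
Qed.

Lemma compact_closure A : bounded_set A -> compact (closure A).
Proof.
move=> [M [_ H]]; have bA x : A x -> `|x| <= M + 1 by apply: H; rewrite ltrDl.
have AK : A `<=` closed_ball_ Num.norm (0 : 'cV[R]_N) (M + 1).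
  by move=> x /bA; rewrite /closed_ball_/= sub0r normrN.
apply: compact_cV; last exact: closed_closure.
exists (M + 1); split; first exact: num_real.
move=> M' hM x /(closureS AK).
rewrite -(closure_id _).1; last exact: closed_closed_ball_.
rewrite /closed_ball_/= sub0r normrN => hx.
exact: le_trans hx (ltW hM).
Qed.

End Vectors.
Section Rayleigh.
Variables (R : realType) (N : nat).
Implicit Types (X : 'M[R]_N) (x y d : 'cV[R]_N).

Definition quad X d : R := dot d (X *m d).

Lemma dot_mx x y : dot x y = (x^T *m y) ord0 ord0.
Proof. by rewrite mxE; apply: eq_bigr => i _; rewrite mxE. Qed.

Lemma dot_mulmx X x y : dot x (X *m y) = dot (X^T *m x) y.
Proof. by rewrite !dot_mx trmx_mul trmxK mulmxA. Qed.

Lemma quadE X d : quad X d = \sum_i \sum_j X i j * d i ord0 * d j ord0.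
Proof.
apply: eq_bigr => i _; rewrite mxE mulr_sumr; apply: eq_bigr => j _.
by rewrite mulrCA mulrA.
Qed.

Lemma quadZ X t d : quad X (t *: d) = t ^+ 2 * quad X d.
Proof. by rewrite /quad -scalemxAr dotZl dotZr mulrA expr2. Qed.

Lemma cont_coord (f : 'cV[R]_N -> 'cV[R]_N) x i : {for x, continuous f} ->
  {for x, continuous (fun z => f z i ord0)}.
Proof.
by move=> cf; apply: (@continuous_comp _ _ _ f (fun M : 'cV[R]_N => M i ord0)) => //;
  exact: coord_continuous.
Qed.

Lemma cont_dot (f g : 'cV[R]_N -> 'cV[R]_N) x :
  {for x, continuous f} -> {for x, continuous g} ->
  {for x, continuous (fun z => dot (f z) (g z))}.
Proof.
move=> cf cg; apply: cont_sum => i.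
by apply: cont_mul; [exact: (@cont_coord f x i cf)|exact: (@cont_coord g x i cg)].
Qed.

Lemma nsq_continuous : continuous (@nsq R N).
Proof.
move=> x; rewrite (_ : @nsq R N = fun z => dot z z); last exact/funext/nsqE.
by apply: cont_dot; exact: cvg_id.
Qed.

Lemma mulmx_continuous X : continuous (fun d : 'cV[R]_N => X *m d).
Proof.
move=> d; apply: cont_cV => i.
rewrite (_ : (fun z : 'cV[R]_N => _) = fun z => \sum_k X i k * z k ord0); last first.
  by apply/funext => z; rewrite mxE.
apply: cont_sum => k.
by apply: cont_mul; [exact: cont_cst|exact: coord_continuous].
Qed.

Lemma quad_continuous X : continuous (quad X).
Proof. by move=> x; apply: cont_dot; [exact: cvg_id|exact: mulmx_continuous]. Qed.

Lemma max_eigenvalue X : (0 < N)%N -> X^T = X ->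
  exists2 a, eigenvalue X a & forall d, quad X d <= a * nsq d.
Proof.
move=> N0 sX; pose S : set 'cV[R]_N := [set d | nsq d = 1].
have S0 : S !=set0.
  exists (unitv R (Ordinal N0)); rewrite /S/= /nsq (bigD1 (Ordinal N0))//=.
  rewrite big1 ?mxE ?eqxx ?expr1n ?addr0// => i /negPf ni.
  by rewrite mxE ni /= expr0n.
have cS : compact S.
  apply: compact_cV.
    exists 1; split=> // M hM d /= Sd; apply: ltW; apply: le_lt_trans hM.
    apply: le_trans (norm_le_enorm _) _.
    by rewrite /enorm -/(nsq d) Sd sqrtr1.
  rewrite (_ : S = @nsq R N @^-1` [set 1])//.
  by apply: preimage_closed => [x _|]; [exact: nsq_continuous|exact: closed_eq].
have [d0 /set_mem d0S maxd] := compact_EVT_max S0 cS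
  (continuous_subspaceT (@quad_continuous X)).
have n0 : nsq d0 = 1 by [].
have le d : quad X d <= quad X d0 * nsq d.
  have [->|dn0] := eqVneq d 0.
    by rewrite -(scale0r 0) quadZ nsqZ expr0n/= !mul0r mulr0.
  have ed := enorm_gt0 dn0.
  have /maxd : (enorm d)^-1 *: d \in S.
    by rewrite inE /S/= nsqZ -sqr_enorm -exprMn mulVf ?expr1n// gt_eqF.
  rewrite quadZ exprVn ler_pdivrMl ?exprn_gt0// mulrC sqr_enorm.
  by [].
exists (quad X d0) => //; apply/eigenvalueP; exists d0^T; last first.
  have [/(congr1 trmx)|//] := eqVneq d0^T 0; rewrite trmxK trmx0 => d00.
  move: n0; rewrite d00 -(scale0r 0) nsqZ expr0n/= mul0r => /esym/eqP.
  by rewrite oner_eq0.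
set a := quad X d0.
have [w wE] : exists w, w = X *m d0 - a *: d0 by eexists.
have w0 : w = 0.
  apply: nsq_eq0; set n := nsq w.
  pose b := a * nsq w - quad X w.
  have b0 : 0 <= b by rewrite subr_ge0; exact: le.
  have H t : 0 <= t ^+ 2 * b - 2 * t * n.
    have := le (d0 + t *: w); rewrite -subr_ge0; congr (_ <= _).
    rewrite nsqE /quad mulmxDr -scalemxAr !dotE -!nsqE n0 -/(quad X d0) -/a.
    rewrite (dot_mulmx X d0 w) sX -/(quad X w).
    have -> : n = dot w (X *m d0) - a * dot w d0.
      by rewrite /n nsqE {2}wE dotDr dotNr dotZr.
    by rewrite /b (dotC d0 w) (dotC (X *m d0) w); ring.
  have b1 : b + 1 != 0 by rewrite gt_eqF// ltr_wpDl.
  have := H (n / (b + 1)).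
  have -> : (n / (b + 1)) ^+ 2 * b - 2 * (n / (b + 1)) * n =
            - ((n / (b + 1)) ^+ 2 * (b + 2)) by field.
  rewrite oppr_ge0 pmulr_lle0 ?ltr_wpDl// => h.
  have /eqP : (n / (b + 1)) ^+ 2 = 0 by apply/eqP; rewrite eq_le h sqr_ge0.
  by rewrite sqrf_eq0 mulf_eq0 invr_eq0 (negPf b1) orbF => /eqP.
rewrite -[X]sX -trmx_mul -[a *: _]linearZ /=; congr trmx.
by apply/eqP; rewrite -subr_eq0 -wE w0.
Qed.

Lemma eigenvalue_quad X a : eigenvalue X a ->
  exists2 d, d != 0 & quad X d = a * nsq d.
Proof.
move=> /eigenvalueP[v vX v0]; exists v^T.
  by apply: contra_neq v0 => /(congr1 trmx); rewrite trmxK trmx0.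
by rewrite /quad nsqE dot_mulmx -trmx_mul vX linearZ /= dotZl.
Qed.

Lemma P1plusE X : (0 < N)%N -> X^T = X ->
  (forall d, quad X d <= P1plus X * nsq d) /\
  (exists2 d, d != 0 & quad X d = P1plus X * nsq d).
Proof.
move=> N0 sX; have [a ea Ha] := max_eigenvalue N0 sX.
have ub : ubound [set a : R | eigenvalue X a] a.
  move=> b /eigenvalue_quad[d d0 qd].
  by have := Ha d; rewrite qd ler_pM2r// nsq_gt0.
suff -> : P1plus X = a by split=> //; exact: eigenvalue_quad.
apply/eqP; rewrite eq_le; apply/andP; split.
  by apply: ge_sup => //; exists a.
by apply: ub_le_sup => //; exists a.
Qed.

Lemma quad_le_P1plus X d : (0 < N)%N -> X^T = X -> quad X d <= P1plus X * nsq d.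
Proof. by move=> N0 sX; case: (P1plusE N0 sX). Qed.

Lemma P1plus_le X m : (0 < N)%N -> X^T = X ->
  (forall d, quad X d <= m * nsq d) -> P1plus X <= m.
Proof.
move=> N0 sX H; case: (P1plusE N0 sX) => _ [d d0 qd].
by have := H d; rewrite qd ler_pM2r// nsq_gt0.
Qed.

End Rayleigh.
Section OneVariable.
Variable R : realType.
Implicit Types f df G : R -> R.

Lemma mvt_sym f df t : (forall s : R, `|s| <= `|t| -> is_derive s (1 : R) f (df s)) ->
  exists2 s, `|s| <= `|t| & f t - f 0 = t * df s.
Proof.
move=> dfP.
have main a b : a <= b -> (forall s : R, a <= s <= b -> is_derive s (1 : R) f (df s)) ->
    exists2 s, a <= s <= b & f b - f a = df s * (b - a).
  move=> ab H.
  have [s|//|s sab E] := @MVT_segment R f df a b ab.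
  - by rewrite in_itv/= => /andP[/ltW h1 /ltW h2]; apply: H; rewrite h1 h2.
  - apply: derivable_within_continuous => s; rewrite in_itv/= => /H ds.
    exact: ex_derive.
  - by exists s.
have [t0|/ltW t0] := leP 0 t.
  have [s|s /andP[s0 st] E] := main 0 t t0.
    by move=> /andP[s0 st]; apply: dfP; rewrite !ger0_norm.
  by exists s; [rewrite !ger0_norm|rewrite E subr0 mulrC].
have [s|s /andP[s0 st] E] := main t 0 t0.
  by move=> /andP[s0 st]; apply: dfP; rewrite !ler0_norm// lerN2.
exists s; first by rewrite !ler0_norm// lerN2.
by rewrite -opprB E sub0r mulrN opprK mulrC.
Qed.

Lemma sdiff_le_second_derivative G G1 G2 m :
  (forall t : R, `|t| <= 1 -> is_derive t (1 : R) G (G1 t)) ->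
  (forall t : R, `|t| <= 1 -> is_derive t (1 : R) G1 (G2 t)) ->
  (forall t, `|t| <= 1 -> G2 t <= m) ->
  G 1 + G (- 1) - 2 * G 0 <= m.
Proof.
move=> dG dG1 G2m.
pose K t := G t + G (- t) - m * t ^+ 2.
have dK (t : R) : `|t| <= 1 -> is_derive t (1 : R) K (G1 t - G1 (- t) - m * (2 * t)).
  move=> t1.
  have h1 := dG t t1.
  have h2 : is_derive (- t) (1 : R) G (G1 (- t)) by apply: dG; rewrite normrN.
  have h3 : is_derive t (1 : R) (fun s => G (- s)) (G1 (- t) * -1).
    by apply: (@is_derive1_comp _ G -%R t).
  have h4 : is_derive t (1 : R) (fun s => m * s ^+ 2) (m * (2 * t)).
    apply: is_derive_eq; rewrite /GRing.scale/=; ring.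
  by apply: is_derive_eq (is_deriveB (is_deriveD h1 h3) h4) _; rewrite mulrN1.
have [||s s1 E] := @MVT_segment R K (fun t => G1 t - G1 (- t) - m * (2 * t)) 0 1 ler01.
- move=> t; rewrite in_itv/= => /andP[/ltW t0 /ltW t1]; apply: dK.
  by rewrite ger0_norm.
- apply: derivable_within_continuous => t; rewrite in_itv/= => /andP[t0 t1].
  by have := dK t; rewrite ger0_norm// => /(_ t1) h; exact: ex_derive.
move: s1; rewrite in_itv/= => /andP[s0 s1].
suff : G1 s - G1 (- s) - m * (2 * s) <= 0.
  by move: E; rewrite /K oppr0 => E H; nra.
pose L t := G1 t - G1 (- t).
have [r rs E2] : exists2 r, `|r| <= `|s| & L s - L 0 = s * (G2 r + G2 (- r)).
  apply: mvt_sym => r rs.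
  have r1 : `|r| <= 1 by rewrite (le_trans rs)// ger0_norm.
  have h1 := dG1 r r1.
  have h2 : is_derive (- r) (1 : R) G1 (G2 (- r)) by apply: dG1; rewrite normrN.
  have h3 : is_derive r (1 : R) (fun s => G1 (- s)) (G2 (- r) * -1).
    by apply: (@is_derive1_comp _ G1 -%R r).
  by apply: is_derive_eq (is_deriveB h1 h3) _; rewrite mulrN1 opprK.
have r1 : `|r| <= 1 by rewrite (le_trans rs)// ger0_norm.
have := G2m r r1; have : G2 (- r) <= m by apply: G2m; rewrite normrN.
by move: E2; rewrite /L oppr0 => E2 H1 H2; nra.
Qed.

End OneVariable.

Section Calculus.
Variables (R : realType) (N : nat).
Implicit Types (x y z d v : 'cV[R]_N) (A : set 'cV[R]_N) (g : 'cV[R]_N -> R).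

Lemma mvt_dir g z v t (dg : 'cV[R]_N -> R) :
  (forall s, `|s| <= `|t| -> is_derive (z + s *: v) v g (dg (z + s *: v))) ->
  exists2 s, `|s| <= `|t| & g (z + t *: v) - g z = t * dg (z + s *: v).
Proof.
move=> H; have [s|s st E] := @mvt_sym R (fun s => g (z + s *: v))
  (fun s => dg (z + s *: v)) t.
  by move=> st; apply/is_derive_line; exact: H.
by exists s => //; rewrite -E scale0r addr0.
Qed.

Lemma C1_is_derive A g x i : C1_on A g -> A x ->
  is_derive x (unitv R i) g (partial i g x).
Proof. by move=> [_ /(_ i)[dg _]] Ax; apply: DeriveDef => //; exact: dg. Qed.

Lemma C1_strict A g x : open A -> C1_on A g -> A x -> forall e, 0 < e ->
  exists2 r, 0 < r & forall z z', `|z - x| < r -> `|z' - x| < r ->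
  `|g z' - g z - \sum_i (z' i ord0 - z i ord0) * partial i g x| <=
    e * \sum_i `|z' i ord0 - z i ord0|.
Proof.
move=> oA gC1 Ax e e0.
have [r1 r10 H1] := open_norm oA Ax.
have [|r2 r20 H2] := @cont_eps_fin _ _ _ (fun i => partial i g) x _ e e0.
  by move=> i; case: (gC1.2 i) => _; apply.
pose r := Num.min r1 r2 / 3.
have rp : 0 < r by rewrite divr_gt0// lt_min r10.
have r3 : r + (r + r) <= Num.min r1 r2 by rewrite /r; lra.
exists r => // z z' zx z'x.
pose mix k : 'cV[R]_N := \col_i (if (i < k)%N then z' i ord0 else z i ord0).
have m0 : mix 0%N = z by apply/colP => i; rewrite mxE.
have mN : mix N = z' by apply/colP => i; rewrite mxE ltn_ord.
have mixS (k : 'I_N) : mix k.+1 = mix k + (z' k ord0 - z k ord0) *: unitv R k.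
  apply/colP => i; rewrite !mxE eqxx andbT ltnS leq_eqVlt -val_eqE/=.
  case: ltngtP => [ik|ik|/val_inj ->] /=; rewrite ?mulr0 ?addr0// mulr1.
  by rewrite addrC subrK.
have mixr k : `|mix k - x| <= Num.max `|z - x| `|z' - x|.
  apply: norm_le_coord => [|i]; first by rewrite le_max normr_ge0.
  rewrite !mxE le_max; case: ifP => _.
    by have := coord_le_norm (z' - x) i; rewrite !mxE => ->; rewrite orbT.
  by have := coord_le_norm (z - x) i; rewrite !mxE => ->.
have near_mix (k : 'I_N) s : `|s| <= `|z' k ord0 - z k ord0| ->
    `|mix k + s *: unitv R k - x| < Num.min r1 r2.
  move=> sk; apply: lt_le_trans r3.
  rewrite addrAC (le_lt_trans (ler_normD _ _))// ltrD//.
    by rewrite (le_lt_trans (mixr k))// gt_max zx.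
  rewrite normrZ (@le_lt_trans _ _ `|s|)//.
    by rewrite ler_piMr// normr_unitv.
  apply: le_lt_trans sk _.
  have -> : z' k ord0 - z k ord0 = (z' - x) k ord0 - (z - x) k ord0.
    by rewrite !mxE; ring.
  rewrite (le_lt_trans (ler_normB _ _))// ltrD// (le_lt_trans (coord_le_norm _ _))//.
have -> : g z' - g z = \sum_(k < N) (g (mix k.+1) - g (mix k)).
  by rewrite -(big_mkord xpredT (fun k => g (mix k.+1) - g (mix k))) telescope_sumr// m0 mN.
rewrite -sumrB mulr_sumr (le_trans (ler_norm_sum _ _ _))// ler_sum// => k _.
have [|s st E] := @mvt_dir g (mix k) (unitv R k) (z' k ord0 - z k ord0) (partial k g).
  move=> s /near_mix h; apply: C1_is_derive gC1 _; apply: H1.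
  by rewrite (lt_le_trans h)// ge_min lexx.
rewrite mixS E -mulrBr normrM mulrC ler_wpM2r// ltW// H2//.
by rewrite (lt_le_trans (near_mix _ _ st))// ge_min lexx orbT.
Qed.

Lemma sum_coord_le_norm x : \sum_i `|x i ord0| <= N%:R * `|x|.
Proof.
rewrite -[X in X%:R](card_ord N) mulr_natl -sumr_const ler_sum// => i _.
exact: coord_le_norm.
Qed.

Lemma C1_line A g x d : open A -> C1_on A g -> A x ->
  is_derive x d g (\sum_i d i ord0 * partial i g x).
Proof.
move=> oA gC1 Ax; apply/is_derive_epsP => e e0.
have Nd : 0 <= N%:R * `|d| by rewrite mulr_ge0.
pose c := N%:R * `|d| + `|d| + 1.
have c0 : 0 < c by rewrite ltr_wpDl// addr_ge0.
have [r r0 H] := C1_strict oA gC1 Ax (divr_gt0 e0 c0).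
exists (r / c) => [|h hr]; first exact: divr_gt0.
have hr' : `|h| * c < r by rewrite -ltr_pdivlMr.
have := H x (x + h *: d); rewrite subrr normr0 r0 => /(_ isT).
rewrite addrC addKr normrZ => H1.
apply: le_trans (_ : e / c * (`|h| * (N%:R * `|d|)) <= _); last first.
  rewrite -mulrA (ler_wpM2l (ltW e0))// ler_pdivrMl// mulrC ler_wpM2r// /c.
  by rewrite -addrA lerDl addr_ge0.
apply: le_trans (le_trans (H1 _) _).
- rewrite [x + _]addrC mulr_sumr le_eqVlt; apply/orP; left; apply/eqP.
  by congr `| _ - _ |; apply: eq_bigr => i _; rewrite !mxE; ring.
- by apply: le_lt_trans hr'; rewrite ler_wpM2l// /c; lra.
- rewrite (ler_wpM2l (divr_ge0 (ltW e0) (ltW c0)))//.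
  rewrite (eq_bigr (fun i => `|(h *: d) i ord0|)) => [|i _]; last first.
    by congr `| _ |; rewrite !mxE; ring.
  by rewrite (le_trans (sum_coord_le_norm _))// normrZ mulrCA.
Qed.

Lemma C2_line A g x d : open A -> C2_on A g -> A x ->
  is_derive x d (fun z => \sum_i d i ord0 * partial i g z) (quad (hessian g x) d).
Proof.
move=> oA [_ gC2] Ax.
have h i : is_derive x d (partial i g) (\sum_j d j ord0 * partial j (partial i g) x).
  exact: C1_line oA (gC2 i) Ax.
have h2 i : is_derive x d (fun z => d i ord0 * partial i g z)
    (d i ord0 * \sum_j d j ord0 * partial j (partial i g) x).
  exact: (@is_deriveZ _ _ _ _ (d i ord0) _ _ _ (h i)).
have h3 := is_derive_sum h2; move: h3.
rewrite (_ : \sum_(i < N) _ = fun z => \sum_i d i ord0 * partial i g z); last first.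
  by apply/funext => z; rewrite fct_sumE.
move=> h3; apply: is_derive_eq h3 _; rewrite quadE; apply: eq_bigr => i _.
by rewrite mulr_sumr; apply: eq_bigr => j _; rewrite mxE; ring.
Qed.

Lemma hessian_sym A g x : open A -> C2_on A g -> A x ->
  (hessian g x)^T = hessian g x.
Proof.
move=> oA gC2 Ax.
suff main (i j : 'I_N) e : 0 < e -> exists2 r, 0 < r & forall h, 0 < h -> h < r ->
    `|g (x + h *: unitv R i + h *: unitv R j) - g (x + h *: unitv R i)
      - g (x + h *: unitv R j) + g x - h * (h * partial j (partial i g) x)| <= e * h ^+ 2.
  apply/matrixP => i j; rewrite !mxE.
  apply/eqP; rewrite -subr_eq0 -normr_eq0; apply/eqP/le_anti.
  rewrite normr_ge0 andbT; apply/ler_addgt0Pl => e e0; rewrite addr0.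
  have e2 : 0 < e / 2 by rewrite divr_gt0.
  have [r1 r10 H1] := main i j _ e2; have [r2 r20 H2] := main j i _ e2.
  pose h := Num.min r1 r2 / 2.
  have h0 : 0 < h by rewrite divr_gt0// lt_min r10.
  have hm : h < Num.min r1 r2 by rewrite /h ltr_pdivrMr// ltr_pMr ?ltr1n// lt_min r10.
  move: hm; rewrite lt_min => /andP[hr1 hr2].
  have := H1 h h0 hr1; have := H2 h h0 hr2.
  rewrite [x + _ + _ in X in X -> _]addrAC.
  set a := g _; set b := g _; set c := g _; set D := g x.
  set p := partial _ _ _; set q := partial _ _ _ => h1 h2.
  rewrite -(@ler_pM2l _ (h ^+ 2)) ?exprn_gt0// -[h ^+ 2 in leLHS]ger0_norm ?sqr_ge0//.
  rewrite -normrM.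
  move: h1 h2 => /ler_normlP[h1 h1'] /ler_normlP[h2 h2'].
  by apply/ler_normlP; split; lra.
move=> e0; have [_ /(_ i) pC1] := gC2.
have [r1 r10 H1] := open_norm oA Ax.
have N0 : (0 : R) < N.+2%:R by [].
have [r2 r20 H2] := C1_strict oA pC1 Ax (divr_gt0 e0 N0).
pose r := Num.min r1 r2 / 2.
have r0 : 0 < r by rewrite divr_gt0// lt_min r10.
have rr : r + r = Num.min r1 r2 by rewrite /r; field.
exists r => // h h0 hr.
have near s t : `|s| <= h -> `|t| <= h ->
    `|x + s *: unitv R i + t *: unitv R j - x| < Num.min r1 r2.
  move=> sh th; rewrite -rr [_ - x]addrC !addrA addNr add0r.
  rewrite (le_lt_trans (ler_normD _ _))// ltrD// normrZ.
    by rewrite (le_lt_trans _ hr)// (le_trans _ sh)// ler_piMr// normr_unitv.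
  by rewrite (le_lt_trans _ hr)// (le_trans _ th)// ler_piMr// normr_unitv.
have hh : `|h| <= h by rewrite ger0_norm// ltW.
have h00 : `|0 : R| <= h by rewrite normr0 ltW.
pose k s := g (x + s *: unitv R i + h *: unitv R j) - g (x + s *: unitv R i).
have [|s sh E] := @mvt_sym R k (fun s => partial i g (x + s *: unitv R i + h *: unitv R j) - partial i g (x + s *: unitv R i)) h.
  move=> s; rewrite (ger0_norm (ltW h0)) => sh.
  have d1 : is_derive s (1 : R) (fun s => g (x + s *: unitv R i)) (partial i g (x + s *: unitv R i)).
    apply/is_derive_line; apply: C1_is_derive gC2.1 _; apply: H1.
    by have := near s 0 sh h00; rewrite scale0r addr0 lt_min => /andP[].
  have d2 : is_derive s (1 : R) (fun s => g (x + s *: unitv R i + h *: unitv R j)) (partial i g (x + s *: unitv R i + h *: unitv R j)).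
    rewrite addrAC (_ : (fun s => _) = fun s => g (x + h *: unitv R j + s *: unitv R i)); last first.
      by apply/funext => t; rewrite addrAC.
    apply/is_derive_line; apply: C1_is_derive gC2.1 _; apply: H1.
    by have := near s h sh hh; rewrite [x + _ + _]addrAC lt_min => /andP[].
  exact: is_deriveB d2 d1.
rewrite (ger0_norm (ltW h0)) in sh.
have := H2 (x + s *: unitv R i) (x + s *: unitv R i + h *: unitv R j).
have := near s 0 sh h00; rewrite scale0r addr0 lt_min => /andP[_ ->] /(_ isT).
have := near s h sh hh; rewrite lt_min => /andP[_ ->] /(_ isT).
have cE l : (x + s *: unitv R i + h *: unitv R j) l ord0 - (x + s *: unitv R i) l ord0 = h * (l == j)%:R.
  by rewrite !mxE eqxx !andbT; ring.
rewrite (bigD1 j)//= big1 => [|l /negPf lj]; last by rewrite cE lj mulr0 mul0r.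
rewrite cE eqxx mulr1 addr0 [X in _ <= _ * X](bigD1 j)//= big1 => [|l /negPf lj]; last first.
  by rewrite cE lj mulr0 normr0.
rewrite cE eqxx mulr1 addr0 (ger0_norm (ltW h0)) => H3.
have -> : g (x + h *: unitv R i + h *: unitv R j) - g (x + h *: unitv R i) -
  g (x + h *: unitv R j) + g x = k h - k 0.
  by rewrite /k scale0r !addr0; ring.
rewrite E -mulrBr normrM (ger0_norm (ltW h0)) mulrC expr2 mulrA (ler_wpM2r (ltW h0))//.
apply: le_trans H3 _; rewrite (ler_wpM2r (ltW h0))// ler_pdivrMr// ler_peMr ?(ltW e0)//.
by rewrite ler1n.
Qed.

End Calculus.
Section SecondDifferences.
Variables (R : realType) (N : nat).
Implicit Types (x y z d : 'cV[R]_N) (A : set 'cV[R]_N) (g : 'cV[R]_N -> R).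

Lemma hessianE g x i j : hessian g x i j = partial j (partial i g) x.
Proof. by rewrite mxE. Qed.

Lemma quad_perturb (X Y : 'M[R]_N) e d : 0 <= e ->
  (forall i j, `|X i j - Y i j| <= e) ->
  `|quad X d - quad Y d| <= N%:R ^+ 2 * e * nsq d.
Proof.
move=> e0 XY; rewrite !quadE -sumrB.
apply: le_trans (_ : \sum_(i < N) \sum_(j < N) e * nsq d <= _); last first.
  have E (c : R) : \sum_(i < N) c = N%:R * c by rewrite sumr_const card_ord mulr_natl.
  by rewrite !E expr2 !mulrA.
rewrite (le_trans (ler_norm_sum _ _ _))// ler_sum// => i _.
rewrite -sumrB (le_trans (ler_norm_sum _ _ _))// ler_sum// => j _.
rewrite -!mulrA -mulrBl normrM ler_pM// normrM.
by rewrite -sqr_enorm expr2 ler_pM// coord_le_enorm.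
Qed.

Lemma sdiff_le A g z d m : open A -> C2_on A g ->
  (forall t, `|t| <= 1 -> A (z + t *: d)) ->
  (forall t, `|t| <= 1 -> quad (hessian g (z + t *: d)) d <= m) ->
  sdiff g z d <= m.
Proof.
move=> oA gC2 Ad qm; rewrite /sdiff.
have := @sdiff_le_second_derivative R (fun t => g (z + t *: d))
  (fun t => \sum_i d i ord0 * partial i g (z + t *: d))
  (fun t => quad (hessian g (z + t *: d)) d) m _ _ qm.
rewrite scale1r scaleN1r scale0r addr0; apply=> t t1.
  by apply/is_derive_line; apply: C1_line oA gC2.1 (Ad _ t1).
apply/(@is_derive_line _ _ (fun y => \sum_i d i ord0 * partial i g y)).
exact: C2_line oA gC2 (Ad _ t1).
Qed.

Lemma sdiff_ge A g z d m : open A -> C2_on A g ->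
  (forall t, `|t| <= 1 -> A (z + t *: d)) ->
  (forall t, `|t| <= 1 -> m <= quad (hessian g (z + t *: d)) d) ->
  m <= sdiff g z d.
Proof.
move=> oA gC2 Ad qm; rewrite /sdiff -lerN2.
have := @sdiff_le_second_derivative R (fun t => - g (z + t *: d))
  (fun t => - \sum_i d i ord0 * partial i g (z + t *: d))
  (fun t => - quad (hessian g (z + t *: d)) d) (- m) _ _ _.
rewrite scale1r scaleN1r scale0r addr0 => H.
apply: le_trans (H _ _ _); first by lra.
- move=> t t1; apply: is_deriveN.
  by apply/is_derive_line; apply: C1_line oA gC2.1 (Ad _ t1).
- move=> t t1; apply: is_deriveN.
  apply/(@is_derive_line _ _ (fun y => \sum_i d i ord0 * partial i g y)).
  exact: C2_line oA gC2 (Ad _ t1).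
- by move=> t t1; rewrite lerN2 qm.
Qed.

Lemma C2_sdiff A g x : open A -> C2_on A g -> A x -> forall e, 0 < e ->
  exists2 r, 0 < r & forall z d, `|z - x| < r -> `|d| < r ->
    `|sdiff g z d - quad (hessian g x) d| <= e * nsq d.
Proof.
move=> oA gC2 Ax e e0.
have N0 : (0 : R) < N%:R ^+ 2 + 1 by rewrite ltr_wpDl// sqr_ge0.
have [r1 r10 H1] := open_norm oA Ax.
have [|r2 r20 H2] := @cont_eps_fin _ _ _
  (fun (ij : 'I_N * 'I_N) z => hessian g z ij.1 ij.2) x _ _ (divr_gt0 e0 N0).
  move=> [i j]; rewrite (_ : (fun z => _) = partial j (partial i g)); last first.
    by apply/funext => z; rewrite hessianE.
  by case: (gC2.2 i) => _ /(_ j)[_]; apply.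
exists (Num.min r1 r2 / 2); first by rewrite divr_gt0// lt_min r10.
move=> z d zx dr.
have ball t : `|t| <= 1 -> `|z + t *: d - x| < Num.min r1 r2.
  move=> t1; rewrite addrAC (le_lt_trans (ler_normD _ _))//.
  apply: lt_le_trans (_ : Num.min r1 r2 / 2 + Num.min r1 r2 / 2 <= _); last lra.
  by rewrite ltrD// (le_lt_trans _ dr)// normrZ ler_piMl.
have Ad t : `|t| <= 1 -> A (z + t *: d).
  by move=> /ball; rewrite lt_min => /andP[/H1].
have qd t : `|t| <= 1 -> `|quad (hessian g (z + t *: d)) d - quad (hessian g x) d| <= e * nsq d.
  move=> t1; apply: le_trans (@quad_perturb _ _ (e / (N%:R ^+ 2 + 1)) d _ _) _.
  - by rewrite divr_ge0// ltW.
  - have := ball t t1; rewrite lt_min => /andP[_ h] i j.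
    exact: ltW (H2 (i, j) _ h).
  - rewrite ler_wpM2r ?nsq_ge0// mulrCA ger_pMr// ler_pdivrMr// mul1r.
    by rewrite lerDl.
have lo : quad (hessian g x) d - e * nsq d <= sdiff g z d.
  apply: sdiff_ge oA gC2 Ad _ => t /qd /ler_normlP[h1 _].
  by rewrite lerBlDr -lerBlDl -opprB.
have hi : sdiff g z d <= quad (hessian g x) d + e * nsq d.
  apply: sdiff_le oA gC2 Ad _ => t /qd /ler_normlP[_ h2].
  by rewrite -lerBlDl.
by rewrite ler_distl lo hi.
Qed.

Lemma sdiff_le_P1plus A g x : (0 < N)%N -> open A -> C2_on A g -> A x ->
  forall e, 0 < e -> exists2 r, 0 < r & forall z d, `|z - x| < r -> `|d| < r ->
    sdiff g z d <= (P1plus (hessian g x) + e) * nsq d.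
Proof.
move=> N0 oA gC2 Ax e e0; have [r r0 H] := C2_sdiff oA gC2 Ax e0.
exists r => // z d zx dr; have /ler_normlP[_] := H z d zx dr.
have := quad_le_P1plus d N0 (hessian_sym oA gC2 Ax).
by lra.
Qed.

Lemma P1plus_hessian_le A g x m : (0 < N)%N -> open A -> C2_on A g -> A x ->
  (forall e, 0 < e -> exists2 r, 0 < r & forall d, `|d| < r ->
     sdiff g x d <= (m + e) * nsq d) ->
  P1plus (hessian g x) <= m.
Proof.
move=> N0 oA gC2 Ax H; apply: (P1plus_le N0 (hessian_sym oA gC2 Ax)) => d.
have [->|d0] := eqVneq d 0.
  by rewrite -(scale0r 0) quadZ nsqZ expr0n/= !mul0r mulr0.
have n0 := nsq_gt0 d0.
rewrite -ler_pdivrMr//; apply/ler_addgt0Pl => e e0.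
have e2 : 0 < e / 2 by rewrite divr_gt0.
have [r1 r10 H1] := H _ e2; have [r2 r20 H2] := C2_sdiff oA gC2 Ax e2.
pose t := Num.min r1 r2 / (2 * `|d|).
have m0 : 0 < Num.min r1 r2 by rewrite lt_min r10.
have nd : 0 < `|d| by rewrite normr_gt0.
have t0 : 0 < t by rewrite divr_gt0// mulr_gt0.
have : `|t *: d| < Num.min r1 r2.
  rewrite normrZ gtr0_norm// /t.
  have -> : Num.min r1 r2 / (2 * `|d|) * `|d| = Num.min r1 r2 / 2.
    by field; rewrite gt_eqF.
  by lra.
rewrite lt_min => /andP[tr1 tr2].
have := H1 _ tr1; have := H2 x _ _ tr2; rewrite subrr normr0 => /(_ r20).
rewrite quadZ nsqZ => /ler_normlP[h1 _] h2.
rewrite ler_pdivrMr// -(@ler_pM2l _ (t ^+ 2)) ?exprn_gt0//.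
by move: h1 h2; lra.
Qed.

End SecondDifferences.
Lemma interior_min (R : realType) (F : R -> R) t1 : 0 < t1 < 1 -> F t1 < 0 ->
  (forall t, 0 < t < 1 -> {for t, continuous F}) ->
  (forall e, 0 < e -> exists2 r, 0 < r & forall t, `|t - 0| < r -> - e <= F t) ->
  (forall e, 0 < e -> exists2 r, 0 < r & forall t, `|t - 1| < r -> - e <= F t) ->
  exists2 c, 0 < c < 1 & exists2 r, 0 < r & forall h, `|h| < r -> F c <= F (c + h).
Proof.
move=> /andP[t10 t11] Ft1 cF H0 H1.
have e0 : 0 < - F t1 / 2 by rewrite divr_gt0// oppr_gt0.
have lt2 : F t1 < - (- F t1 / 2) by lra.
have [r0 r00 {}H0] := H0 _ e0; have [r1 r10 {}H1] := H1 _ e0.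
have half (a b : R) : 0 < a -> 0 < b -> exists2 s, 0 < s & s < a /\ s < b.
  move=> a0 b0; exists (Num.min a b / 2); first by rewrite divr_gt0// lt_min a0.
  have m0 : 0 < Num.min a b by rewrite lt_min a0.
  by apply/andP; rewrite -lt_min ltr_pdivrMr// ltr_pMr// ltr1n.
have [s0 s00 [s0r s0t]] := half _ _ r00 t10.
have t1' : 0 < 1 - t1 by rewrite subr_gt0.
have [s1 s10 [s1r s1t]] := half _ _ r10 t1'.
have s1t' : t1 < 1 - s1 by rewrite ltrBrDr -ltrBrDl.
have s11 : 1 - s1 < 1 by rewrite ltrBlDr ltrDl.
have [|c] := @EVT_min R F s0 (1 - s1) (ltW (lt_trans s0t s1t')).
  apply: continuous_in_subspaceT => t; rewrite inE/= in_itv/= => /andP[h1 h2].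
  by apply: cF; rewrite (lt_le_trans s00 h1) (le_lt_trans h2 s11).
rewrite in_itv/= => /andP[c0 c1] minc.
have Fc : F c < - (- F t1 / 2).
  by apply: le_lt_trans lt2; apply: minc; rewrite in_itv/= !ltW.
have c0' : s0 < c.
  rewrite lt_neqAle c0 andbT; apply/eqP => E.
  by have := H0 c; rewrite -E subr0 gtr0_norm// => /(_ s0r); rewrite E leNgt Fc.
have c1' : c < 1 - s1.
  rewrite lt_neqAle c1 andbT; apply/eqP => E.
  have := H1 c; rewrite E addrAC subrr add0r normrN gtr0_norm// => /(_ s1r).
  by rewrite -E leNgt Fc.
exists c; first by rewrite (lt_trans s00)//= (lt_trans c1').
have d0 : 0 < c - s0 by rewrite subr_gt0.
have d1 : 0 < 1 - s1 - c by rewrite subr_gt0.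
have [r r_gt0 [rc0 rc1]] := half _ _ d0 d1.
exists r => // h /ltr_normlP[h1 h2]; apply: minc; rewrite in_itv/=.
by clear -rc0 rc1 h1 h2; apply/andP; split; lra.
Qed.

Section Supersolutions.
Variables (R : realType) (N : nat).
Implicit Types (x y z d a b : 'cV[R]_N) (A : set 'cV[R]_N) (f w : 'cV[R]_N -> R).

(* [m * (t * (1 - t) / 2) * nsq (b - a)] is the gap at [a + t (b - a)] between the
   chord and the parabola of second derivative [m] (in arc length) with the same
   end values.  The end points may lie outside [A]. *)
Definition supersol A f w : Prop := forall a b m,
  (forall t, 0 < t < 1 -> A (a + t *: (b - a)) /\ f (a + t *: (b - a)) <= m) ->
  forall t, 0 < t < 1 ->
  (1 - t) * w a + t * w b - m * (t * (1 - t) / 2) * nsq (b - a) <=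
    w (a + t *: (b - a)).

Definition lsc_at w x : Prop := forall e, 0 < e ->
  exists2 r, 0 < r & forall z, `|z - x| < r -> w x - e <= w z.

Lemma cont_lsc w x : {for x, continuous w} -> lsc_at w x.
Proof.
move=> /cont_epsP cw e /cw[r r0 H]; exists r => // z /H.
by move=> /ltW; rewrite ler_distl => /andP[].
Qed.

Lemma supersol_pointwise A f w :
  (forall x, A x -> {for x, continuous w}) ->
  (forall x, ~ A x -> lsc_at w x) ->
  (forall x, A x -> forall e, 0 < e -> exists2 r, 0 < r &
     forall d, `|d| < r -> sdiff w x d <= (f x + e) * nsq d) ->
  supersol A f w.
Proof.
move=> cw lw Dp a b m H t1 /andP[t10 t11].
have [ab|ab] := eqVneq a b.
  by rewrite -ab subrr scaler0 addr0 -(scale0r 0) nsqZ expr0n/=; lra.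
have D0 : 0 < nsq (b - a) by apply: nsq_gt0; rewrite subr_eq0 eq_sym.
set D := nsq (b - a) in D0 *.
pose p t := a + t *: (b - a).
rewrite -/(p t1) leNgt; apply/negP => lt.
set G := (1 - t1) * w a + t1 * w b - m * (t1 * (1 - t1) / 2) * D - w (p t1).
have G0 : 0 < G by rewrite subr_gt0.
pose e := G / D.
have e0 : 0 < e by rewrite divr_gt0.
have eD : e * D = G by rewrite /e mulfVK// gt_eqF.
pose L t := (m + e) * (t * (1 - t) / 2) * D - (1 - t) * w a - t * w b.
pose F t := w (p t) + L t.
pose eta := - F t1.
have eta0 : 0 < eta.
  rewrite /eta /F /L.
  have -> : - (w (p t1) + ((m + e) * (t1 * (1 - t1) / 2) * D - (1 - t1) * w a - t1 * w b)) =
    G - (e * D) * (t1 * (1 - t1) / 2) by rewrite /G; ring.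
  rewrite eD -[X in X - _]mulr1 -mulrBr mulr_gt0//.
  by nra.
have cL : continuous L.
  move=> t; rewrite /L.
  apply: (@cont_sub R R^o (fun t => (m + e) * (t * (1 - t) / 2) * D - (1 - t) * w a) (fun t => t * w b)).
    apply: (@cont_sub R R^o (fun t => (m + e) * (t * (1 - t) / 2) * D) (fun t => (1 - t) * w a)).
      apply: cvgMl; apply: cvgMr; apply: cvgMl.
      by apply: cvgM; [exact: cvg_id|apply: cvgB; [exact: cvg_cst|exact: cvg_id]].
    by apply: cvgMl; apply: cvgB; [exact: cvg_cst|exact: cvg_id].
  by apply: cvgMl; exact: cvg_id.
have nba : 0 < `|b - a| by rewrite normr_gt0 subr_eq0 eq_sym.
have pB s t : p t - p s = (t - s) *: (b - a).
  by rewrite /p opprD addrACA subrr add0r -scalerBl.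
have endp s : F s = 0 -> forall e', 0 < e' ->
    exists2 r, 0 < r & forall t, `|t - s| < r -> - e' <= F t.
  move=> Fs e' e'0; have e2 : 0 < e' / 2 by rewrite divr_gt0.
  have lws : lsc_at w (p s).
    by have [As|nAs] := pselect (A (p s)); [exact/cont_lsc/cw|exact: lw].
  have [r1 r10 H1] := lws _ e2.
  have /cont_epsP /(_ _ e2) [r2 r20 H2] := cL s.
  exists (Num.min (r1 / `|b - a|) r2); first by rewrite lt_min divr_gt0.
  move=> t; rewrite lt_min => /andP[ts1 /H2/ltW/ler_normlP[h2 _]].
  have h1 : w (p s) - e' / 2 <= w (p t).
    by apply: H1; rewrite pB normrZ -ltr_pdivlMr.
  by move: Fs h1 h2; rewrite /F; clear; lra.
have F0 : F 0 = 0.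
  by rewrite /F /L /p scale0r addr0; ring.
have F1 : F 1 = 0.
  have -> : F 1 = w b + L 1 by rewrite /F /p scale1r [a + _]addrC subrK.
  by rewrite /L; ring.
have cF t : 0 < t < 1 -> {for t, continuous F}.
  move=> /H[At _]; apply: cvgD; last exact: cL.
  apply: (@continuous_comp _ _ _ p w); last exact: cw At.
  by apply: cvgD; [exact: cvg_cst|apply: cvgZl; exact: cvg_id].
have Ft1 : F t1 < 0 by rewrite -oppr_gt0.
have t01 : 0 < t1 < 1 by rewrite t10.
have [c c01 [s s0 minc]] := interior_min t01 Ft1 cF (endp 0 F0) (endp 1 F1).
have [Ac fc] := H c c01.
have e2 : 0 < e / 2 by rewrite divr_gt0.
have [r r_gt0 Hr] := Dp _ Ac _ e2.
pose h := Num.min (r / `|b - a|) s / 2.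
have hm : 0 < Num.min (r / `|b - a|) s by rewrite lt_min divr_gt0.
have h0 : 0 < h by rewrite divr_gt0.
have : h < Num.min (r / `|b - a|) s by rewrite ltr_pdivrMr// ltr_pMr// ltr1n.
rewrite lt_min => /andP[hr hs].
have := Hr (h *: (b - a)).
rewrite normrZ gtr0_norm// -ltr_pdivlMr// hr => /(_ isT).
rewrite nsqZ -/D /sdiff => sd.
have Fp : F c <= F (c + h) by apply: minc; rewrite gtr0_norm.
have Fm : F c <= F (c - h) by apply: minc; rewrite normrN gtr0_norm.
have pp : p c + h *: (b - a) = p (c + h) by rewrite /p scalerDl addrA.
have pm : p c - h *: (b - a) = p (c - h) by rewrite /p scalerBl addrA.
move: sd; rewrite -/(p c) pp pm => sd.
have hD : 0 < h ^+ 2 * D by rewrite mulr_gt0// exprn_gt0.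
have LL : L (c + h) + L (c - h) - 2 * L c = - (m + e) * (h ^+ 2 * D).
  by rewrite /L; field.
have lo : (m + e) * (h ^+ 2 * D) <= w (p (c + h)) + w (p (c - h)) - 2 * w (p c).
  by move: Fp Fm LL; rewrite /F; clear; lra.
have hi : (f (p c) + e / 2) * (h ^+ 2 * D) < (m + e) * (h ^+ 2 * D).
  by rewrite ltr_pM2r// ler_ltD// ltr_pdivrMr// ltr_pMr// ltr1n.
by have := lt_le_trans hi (le_trans lo sd); rewrite ltxx.
Qed.

End Supersolutions.
Section CosineBarrier.
Variables (R : realType) (N : nat).

Lemma coordB (x y : 'cV[R]_N) i : (x - y) i ord0 = x i ord0 - y i ord0.
Proof. by rewrite !mxE. Qed.

Lemma sqr_sum_le (a : 'I_N -> R) : (\sum_i a i) ^+ 2 <= N%:R * \sum_i a i ^+ 2.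
Proof.
have E (c : R) : \sum_(i < N) c = N%:R * c by rewrite sumr_const card_ord mulr_natl.
have : 0 <= \sum_(i < N) \sum_(j < N) (a i - a j) ^+ 2.
  by apply: sumr_ge0 => i _; apply: sumr_ge0 => j _; exact: sqr_ge0.
rewrite (eq_bigr (fun i => N%:R * a i ^+ 2 + (\sum_j a j ^+ 2) - 2 * a i * \sum_j a j)); last first.
  move=> i _; rewrite -E mulr_sumr -big_split -sumrB; apply: eq_bigr => j _ /=; ring.
rewrite sumrB big_split /= E -mulr_sumr -mulr_suml -mulr_sumr; lra.
Qed.

Lemma sin_le_id (t : R) : 0 <= t -> sin t <= t.
Proof.
move=> t0; have [s _] := @mvt_sym R sin cos t.
by rewrite sin0 subr0 => ->; rewrite ler_piMr// cos_le1.
Qed.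

Lemma cos_le_pihalf_norm (t : R) : - (pi / 2) < t < pi / 2 -> cos t <= pi / 2 - `|t|.
Proof.
move=> /andP[h1 h2]; have -> : cos t = sin (pi / 2 - `|t|).
  by rewrite [_ - `|t|]addrC sinDpihalf cosN cos_norm.
apply: sin_le_id; rewrite subr_ge0 ler_norml; apply/andP; split; lra.
Qed.

Section Line.
Variables (xi eta : 'I_N -> R) (s A : R).
Hypothesis s0 : 0 < s.
Hypothesis sN : s * N%:R <= 1.
Hypothesis A0 : 0 <= A.
Let arg (i : 'I_N) t := xi i + t * eta i.
Hypothesis cos_gt0 : forall i t, `|t| <= 1 -> 0 < cos (arg i t).
Let H t := \sum_i ln (cos (arg i t)).
Let T t := \sum_i eta i * tan (arg i t).
Let T1 t := \sum_i eta i ^+ 2 * (cos (arg i t)) ^- 2.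

Let darg i (t : R) : is_derive t (1 : R) (arg i) (eta i).
Proof.
have h : is_derive t (1 : R) (fun t => t * eta i) (eta i).
  by apply: is_derive_eq (is_deriveM (is_derive_id t (1:R)) (is_derive_cst (eta i) t (1:R))) _;
    rewrite /GRing.scale /= mulr0 add0r mulr1.
by apply: is_derive_eq (is_deriveD (is_derive_cst (xi i) t (1:R)) h) _; rewrite add0r.
Qed.

Let dH (t : R) : `|t| <= 1 -> is_derive t (1 : R) H (- T t).
Proof.
move=> t1.
have h i : is_derive t (1 : R) (fun t => ln (cos (arg i t))) (- (eta i * tan (arg i t))).
  have h1 := is_derive1_comp (is_derive_cos (arg i t)) (darg i t).
  have h2 := is_derive1_comp (is_derive1_ln (cos_gt0 i t1)) h1.
  apply: is_derive_eq h2 _; rewrite /tan; field.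
  by rewrite gt_eqF// cos_gt0.
have := is_derive_sum h; rewrite sumrN.
by rewrite (_ : \sum_(i < N) _ = H)//; apply/funext => z; rewrite fct_sumE.
Qed.

Let dT (t : R) : `|t| <= 1 -> is_derive t (1 : R) T (T1 t).
Proof.
move=> t1.
have h i : is_derive t (1 : R) (fun t => eta i * tan (arg i t)) (eta i ^+ 2 * (cos (arg i t)) ^- 2).
  have c0 : cos (arg i t) != 0 by rewrite gt_eqF// cos_gt0.
  have h1 := is_derive1_comp (is_derive_tan c0) (darg i t).
  apply: is_derive_eq (@is_deriveZ _ _ _ _ (eta i) _ _ _ h1) _.
  by rewrite /GRing.scale /=; ring.
have := is_derive_sum h.
by rewrite (_ : \sum_(i < N) _ = T)//; apply/funext => z; rewrite fct_sumE.
Qed.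

(* With [E = expR (s * H)], [E'' = s E (s T^2 - T')]; Cauchy-Schwarz and [s N <= 1]
   bound [s T^2] by the sum of [eta_i^2 tan^2], leaving [E'' <= - s E |eta|^2]. *)
Lemma cos_barrier_sdiff m :
  (forall t, `|t| <= 1 -> - (A * s) * expR (s * H t) * \sum_i eta i ^+ 2 <= m) ->
  A * expR (s * H 1) + A * expR (s * H (- 1)) - 2 * (A * expR (s * H 0)) <= m.
Proof.
move=> Hm.
pose G1 t := - (A * s) * (expR (s * H t) * T t).
pose G2 t := (A * s) * expR (s * H t) * (s * T t ^+ 2 - T1 t).
have dE (t : R) : `|t| <= 1 ->
    is_derive t (1 : R) (fun t => expR (s * H t)) (- s * (expR (s * H t) * T t)).
  move=> t1; have h1 : is_derive t (1 : R) (fun t => s * H t) (s * - T t).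
    exact: (@is_deriveZ _ _ _ _ s _ _ _ (dH t1)).
  have h2 := @is_derive1_comp R expR (fun t => s * H t) t _ _ (is_derive_expR _) h1.
  apply: is_derive_eq h2 _.
  by rewrite /GRing.scale /=; ring.
apply: (@sdiff_le_second_derivative R (fun t => A * expR (s * H t)) G1 G2).
- move=> t t1; apply: is_derive_eq (@is_deriveZ _ _ _ _ A _ _ _ (dE t t1)) _.
  by rewrite /GRing.scale /= /G1; ring.
- move=> t t1.
  have h := @is_deriveZ _ _ _ _ (- (A * s)) _ _ _ (is_deriveM (dE t t1) (dT t1)).
  by apply: is_derive_eq h _; rewrite /GRing.scale /= /G2; ring.
- move=> t t1; apply: le_trans (Hm t t1).
  have AsE : 0 <= A * s * expR (s * H t) by rewrite mulr_ge0 ?expR_ge0// mulr_ge0// ltW.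
  rewrite /G2 !mulNr -mulrN ler_wpM2l//.
  have -> : T1 t = \sum_i eta i ^+ 2 + \sum_i (eta i * tan (arg i t)) ^+ 2.
    rewrite -big_split; apply: eq_bigr => i _ /=.
    by rewrite cos2_tan2 ?gt_eqF ?cos_gt0//; ring.
  have := sqr_sum_le (fun i => eta i * tan (arg i t)); rewrite -/(T t).
  set S := \sum_i (eta i * _) ^+ 2 => h.
  have S0 : 0 <= S by apply: sumr_ge0 => i _; exact: sqr_ge0.
  have : s * T t ^+ 2 <= s * (N%:R * S) by rewrite ler_wpM2l// ltW.
  have : s * N%:R * S <= 1 * S by rewrite ler_wpM2r.
  lra.
Qed.

End Line.

Variables (c : 'cV[R]_N * 'M[R]_N).
Hypothesis cO : orthogonal_matrices c.2.

Definition rot_coord x : 'cV[R]_N := c.2^T *m x - c.1.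

Lemma rot_cube_coord x : rot_cube c x <->
  forall i, - (pi / 2) < rot_coord x i ord0 < pi / 2.
Proof.
split.
  move=> [p cp <-] i; rewrite /rot_coord mulmxA cO mul1mx !mxE.
  by have [h1 h2] := cp i; apply/andP; split; lra.
move=> H; exists (c.2^T *m x); last by rewrite mulmxA (mulmx1C cO) mul1mx.
by move=> i; have := H i; rewrite /rot_coord !mxE => /andP[h1 h2]; split; lra.
Qed.

Lemma nsq_rot d : nsq (c.2^T *m d) = nsq d.
Proof. by rewrite !nsqE dot_mulmx trmxK mulmxA (mulmx1C cO) mul1mx. Qed.

Lemma rot_coordB x z : rot_coord x - rot_coord z = c.2^T *m (x - z).
Proof. by rewrite /rot_coord mulmxBr opprB addrA subrK. Qed.

Lemma rot_cube_diam x z : rot_cube c x -> rot_cube c z ->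
  enorm (x - z) <= Num.sqrt N%:R * pi.
Proof.
move=> /rot_cube_coord cx /rot_cube_coord cz.
have pi0 := pi_gt0 R.
rewrite -(@ler_pXn2r _ 2)// ?nnegrE ?enorm_ge0 ?mulr_ge0 ?sqrtr_ge0 ?pi_ge0//.
rewrite sqr_enorm -nsq_rot -rot_coordB exprMn sqr_sqrtr//.
have -> : N%:R * pi ^+ 2 = \sum_(i < N) pi ^+ 2 :> R by rewrite sumr_const card_ord mulr_natl.
apply: ler_sum => i _; rewrite coordB; have := cx i; have := cz i.
move=> /andP[h1 h2] /andP[h3 h4].
rewrite -[leLHS]real_normK ?num_real// ler_sqr ?nnegrE ?pi_ge0// ler_norml; apply/andP; split; lra.
Qed.

Lemma rot_phi_pow x (beta : R) : rot_cube c x ->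
  rot_phi c x `^ beta = expR (beta / N%:R * \sum_i ln (cos (rot_coord x i ord0))).
Proof.
move=> /rot_cube_coord cx.
have c0 i : 0 < cos (rot_coord x i ord0) by exact: cos_gt0_pihalf.
rewrite /rot_phi /phi -/(rot_coord x).
rewrite (eq_bigr (fun i => expR (N%:R^-1 * ln (cos (rot_coord x i ord0))))); last first.
  by move=> i _; rewrite /powR gt_eqF.
rewrite -expR_sum -expRM -mulr_sumr; congr expR; ring.
Qed.

Lemma rot_phi_ge0 x : 0 <= rot_phi c x.
Proof. by apply: prodr_ge0 => i _; exact: powR_ge0. Qed.

Lemma rot_phi_pow_le x x0 (beta : R) : 0 <= beta -> rot_cube c x -> ~ rot_cube c x0 ->
  rot_phi c x `^ beta <= enorm (x - x0) `^ (beta / N%:R).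
Proof.
move=> b0 cx cx0; have /rot_cube_coord cxi := cx.
have c0 i : 0 < cos (rot_coord x i ord0) by exact: cos_gt0_pihalf.
have s0 : 0 <= beta / N%:R by rewrite divr_ge0.
have [i hi] : exists i, ~ (- (pi / 2) < rot_coord x0 i ord0 < pi / 2).
  by apply/existsNP => H; apply/cx0/rot_cube_coord.
have ci : cos (rot_coord x i ord0) <= enorm (x - x0).
  apply: le_trans (cos_le_pihalf_norm (cxi i)) _.
  rewrite /enorm -/(nsq _) -nsq_rot -rot_coordB.
  apply: le_trans (coord_le_enorm _ i).
  rewrite [X in _ <= `|X|]coordB.
  have : pi / 2 <= `|rot_coord x0 i ord0|.
    by rewrite leNgt ltr_norml; apply/negP.
  have := ler_normB (rot_coord x i ord0) (rot_coord x i ord0 - rot_coord x0 i ord0).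
  by rewrite subKr; lra.
rewrite rot_phi_pow//.
apply: le_trans (_ : expR (beta / N%:R * ln (cos (rot_coord x i ord0))) <= _).
  rewrite ler_expR ler_wpM2l// (bigD1 i)//= gerDl sumr_le0// => j _.
  by rewrite -ln1 ler_ln ?posrE// cos_le1.
apply: le_trans (_ : cos (rot_coord x i ord0) `^ (beta / N%:R) <= _).
  by rewrite /powR gt_eqF.
by rewrite ge0_ler_powR// nnegrE ?enorm_ge0// ltW.
Qed.

End CosineBarrier.
Section Chords.
Variables (R : realType) (N : nat).
Implicit Types (x y z d : 'cV[R]_N) (A : set 'cV[R]_N) (f w : 'cV[R]_N -> R).

Lemma exit_time A x d (L : R) : open A -> A x -> d != 0 ->
  (forall z, A z -> enorm (z - x) <= L) ->
  exists2 s, 0 < s & [/\ ~ A (x + s *: d), s * enorm d <= L &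
    forall t, 0 <= t < s -> A (x + t *: d)].
Proof.
move=> oA Ax d0 AL; have ed := enorm_gt0 d0.
pose T := [set t | 0 <= t /\ forall s, 0 <= s <= t -> A (x + s *: d)].
have T0 : T 0.
  by split=> // s; rewrite -eq_le => /eqP <-; rewrite scale0r addr0.
have TL t : T t -> t <= L / enorm d.
  move=> [t0 /(_ t)]; rewrite t0 lexx => /(_ isT) /AL.
  by rewrite addrC addKr enormZ ger0_norm// ler_pdivlMr.
have hT : has_sup T by split; [exists 0|exists (L / enorm d)].
have in_T t : 0 <= t < sup T -> A (x + t *: d).
  move=> /andP[t0 tT]; have e0 : 0 < sup T - t by rewrite subr_gt0.
  have [s [_ Ts]] := sup_adherent e0 hT; rewrite subKr => ts.
  by apply: Ts; rewrite t0 ltW.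
have supT0 : 0 <= sup T by apply: ub_le_sup => //; exact: hT.2.
have nA : ~ A (x + sup T *: d).
  move=> /(open_norm oA)[r r0 H].
  have nd : 0 < `|d| by rewrite normr_gt0.
  pose e := r / `|d| / 2.
  have e0 : 0 < e by rewrite !divr_gt0.
  have : T (sup T + e).
    split=> [|s /andP[s0 se]]; first by rewrite addr_ge0// ltW.
    have [sT|Ts] := ltP s (sup T); first by apply: in_T; rewrite s0.
    apply: H; rewrite opprD addrACA subrr add0r -scalerBl normrZ -ltr_pdivlMr//.
    rewrite ger0_norm ?subr_ge0//; have : e < r / `|d| by rewrite /e ltr_pdivrMr// ltr_pMr ?ltr1n// divr_gt0.
    by lra.
  by move=> /(ub_le_sup hT.2); lra.
exists (sup T); last split=> //.
- rewrite lt_neqAle supT0 andbT eq_sym; apply/eqP => s0.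
  by apply: nA; rewrite s0 scale0r addr0.
- rewrite -ler_pdivlMr//; apply: ge_sup; [by exists 0|exact: TL].
Qed.

Lemma supersol_chord A f w x d (M s1 s2 : R) : supersol A f w ->
  (forall z, A z -> f z <= M) -> 0 < s1 -> 0 < s2 ->
  (forall t, - s1 < t < s2 -> A (x + t *: d)) ->
  (s2 * w (x - s1 *: d) + s1 * w (x + s2 *: d)) / (s1 + s2)
    - M / 2 * s1 * s2 * nsq d <= w x.
Proof.
move=> ws fM s10 s20 Ad.
have s12 : 0 < s1 + s2 by rewrite addr_gt0.
pose a := x - s1 *: d; pose b := x + s2 *: d.
have ba : b - a = (s1 + s2) *: d.
  by apply/colP => i; rewrite !mxE; ring.
have pE t : a + t *: (b - a) = x + (t * (s1 + s2) - s1) *: d.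
  by rewrite ba scalerA scalerBl addrA addrAC.
pose t := s1 / (s1 + s2).
have tE : t * (s1 + s2) = s1 by rewrite mulfVK ?gt_eqF.
have t01 : 0 < t < 1 by rewrite divr_gt0//= ltr_pdivrMr// mul1r ltrDl.
have := ws a b M _ t t01; rewrite pE tE subrr scale0r addr0 => H.
apply: le_trans (H _); last first.
  move=> u /andP[u0 u1]; rewrite pE.
  suff h : A (x + (u * (s1 + s2) - s1) *: d) by split=> //; exact: fM.
  apply: Ad; rewrite ltrDr mulr_gt0//=.
  have : u * (s1 + s2) < s1 + s2 by rewrite gtr_pMl.
  by lra.
rewrite ba nsqZ -/a -/b le_eqVlt; apply/orP; left; apply/eqP.
by rewrite /t; field; rewrite gt_eqF.
Qed.

End Chords.

Section Envelope.
Variables (R : realType) (N : nat).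
Hypothesis N0 : (0 < N)%N.
Variables (A : set 'cV[R]_N) (f : 'cV[R]_N -> R) (M L : R).
Hypothesis oA : open A.
Hypothesis AL : forall x z, A x -> A z -> enorm (x - z) <= L.
Hypothesis fM : forall x, A x -> f x <= M.
Hypothesis M0 : 0 <= M.
Hypothesis L0 : 0 <= L.
Implicit Types (x y z d : 'cV[R]_N) (w : 'cV[R]_N -> R).

Definition zero_supersol w : Prop :=
  supersol A f w /\ forall x, ~ A x -> w x = 0.

Definition envelope x : R := inf [set w x | w in zero_supersol].

Lemma zero_supersol_ge w x d : zero_supersol w -> A x -> ~ A (x + d) ->
  - (M / 2 * L * enorm d) <= w x.
Proof.
move=> [ws w0] Ax nAd.
have d0 : d != 0 by apply: contra_notN nAd => /eqP ->; rewrite addr0.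
have [s2 s20 [nA2 sL2 H2]] := exit_time oA Ax d0 (fun z Az => AL Az Ax).
have Nd0 : - d != 0 by rewrite oppr_eq0.
have [s1 s10 [nA1 sL1 H1]] := exit_time oA Ax Nd0 (fun z Az => AL Az Ax).
have s21 : s2 <= 1.
  by rewrite leNgt; apply/negP => s; apply: nAd; rewrite -[d]scale1r; apply: H2; rewrite ler01.
have Ad t : - s1 < t < s2 -> A (x + t *: d).
  move=> /andP[t1 t2]; have [t0|t0] := leP 0 t; first by apply: H2; rewrite t0.
  rewrite -[d]opprK scalerN -scaleNr; apply: H1.
  by rewrite oppr_ge0 ltW//= ltrNl.
have := supersol_chord ws fM s10 s20 Ad.
rewrite (w0 _ nA2) -scalerN (w0 _ nA1) !mulr0 addr0 mul0r add0r.
apply: le_trans; rewrite lerN2 -sqr_enorm.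
rewrite enormN in sL1.
have e0 := enorm_ge0 d.
have -> : M / 2 * s1 * s2 * enorm d ^+ 2 = M / 2 * ((s1 * enorm d) * (s2 * enorm d)) by ring.
rewrite -[M / 2 * L * _]mulrA ler_wpM2l ?divr_ge0//; apply: ler_pM => //.
- by rewrite mulr_ge0// ltW.
- by rewrite mulr_ge0// ltW.
- by rewrite ler_piMl.
Qed.

Lemma envelope_has_lbound x : has_lbound [set w x | w in zero_supersol].
Proof.
have [Ax|nAx] := pselect (A x); last first.
  by exists 0 => _ [w [_ w0] <-]; rewrite w0.
have u0 : unitv R (Ordinal N0) != 0.
  apply/eqP => /colP/(_ (Ordinal N0)); rewrite !mxE !eqxx => /eqP.
  by rewrite oner_eq0.
have [s s0 [nA _ _]] := exit_time oA Ax u0 (fun z Az => AL Az Ax).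
exists (- (M / 2 * L * enorm (s *: unitv R (Ordinal N0)))) => _ [w wW <-].
exact: zero_supersol_ge.
Qed.

Lemma envelope_le w x : zero_supersol w -> envelope x <= w x.
Proof. by move=> wW; apply: (ge_inf (envelope_has_lbound x)); exists w. Qed.

Hypothesis W0 : zero_supersol !=set0.

Lemma le_envelope c x : (forall w, zero_supersol w -> c <= w x) -> c <= envelope x.
Proof.
move=> H; apply: lb_le_inf; last by move=> _ [w wW <-]; exact: H.
by have [w wW] := W0; exists (w x); exists w.
Qed.

Lemma envelope_out x : ~ A x -> envelope x = 0.
Proof.
move=> nAx; apply/eqP; rewrite eq_le; apply/andP; split.
  by have [w wW] := W0; rewrite (le_trans (envelope_le x wW))// wW.2.
by apply: le_envelope => w [_ ->].
Qed.

Lemma envelope_supersol : zero_supersol envelope.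
Proof.
split; last exact: envelope_out.
move=> a b m H t t01; apply: le_envelope => w wW.
apply: le_trans (wW.1 a b m H t t01).
have /andP[t0 t1] := t01.
by rewrite lerD2r lerD// ler_wpM2l ?envelope_le ?subr_ge0// ltW.
Qed.

Lemma envelope_ge x d : A x -> ~ A (x + d) -> - (M / 2 * L * enorm d) <= envelope x.
Proof. by move=> Ax nAd; apply: le_envelope => w wW; exact: zero_supersol_ge. Qed.

Hypothesis convA : forall x y t, A x -> A y -> 0 <= t <= 1 -> A (x + t *: (y - x)).
Variables (B g : R).
Hypothesis B0 : 0 <= B.
Hypothesis g01 : 0 < g <= 1.
Hypothesis ub : forall x x0, A x -> ~ A x0 -> envelope x <= B * enorm (x - x0) `^ g.

(* Apply the chord inequality at [x] on the segment from [y] to the exit point [a]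
   beyond [x]: since the envelope vanishes at [a], only
   [envelope y * |y - x| / |y - a|] remains to be bounded. *)
Lemma envelope_increment x y : A x -> A y -> x != y ->
  envelope y - envelope x <= B * enorm (y - x) `^ g + M / 2 * L * enorm (y - x).
Proof.
move=> Ax Ay xy; set d := y - x.
have d0 : d != 0 by rewrite subr_eq0 eq_sym.
have ed := enorm_gt0 d0.
have Nd0 : - d != 0 by rewrite oppr_eq0.
have [s s0 [nA sL H1]] := exit_time oA Ax Nd0 (fun z Az => AL Az Ax).
have Ad t : - s < t < 1 -> A (x + t *: d).
  move=> /andP[t1 t2]; have [t0|t0] := leP 0 t; first by apply: convA => //; rewrite t0 ltW.
  rewrite -[d]opprK scalerN -scaleNr; apply: H1.
  by rewrite oppr_ge0 ltW//= ltrNl.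
have := supersol_chord envelope_supersol.1 fM s0 ltr01 Ad.
have xd : x + d = y by rewrite /d addrC subrK.
rewrite -scalerN (envelope_out nA) scale1r xd mulr0 add0r mulr1.
rewrite enormN in sL.
have := ub Ay nA.
have -> : y - (x + s *: - d) = (1 + s) *: d.
  by rewrite opprD scalerN opprK addrA scalerDl scale1r.
have s1p : 0 <= 1 + s by rewrite addr_ge0// ltW.
rewrite enormZ (ger0_norm s1p) (powRM _ s1p (ltW ed)).
set U := envelope y; set V := envelope x; set E := enorm d `^ g => h1 h2.
have E0 : 0 <= E by exact: powR_ge0.
have s1 : 0 < s + 1 by rewrite addr_gt0.
have h3 : (1 + s) `^ g <= 1 + s.
  have h : 1 <= 1 + s by rewrite lerDl ltW.
  have /andP[g0 g1] := g01.
  by rewrite -[leRHS](@powRr1 _ (1 + s))// ler_powR.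
have h4 : U <= B * E * (s + 1).
  apply: le_trans h1 _; rewrite [(1 + s) `^ g * E]mulrC mulrA [s + 1]addrC.
  by rewrite ler_wpM2l// mulr_ge0.
have h5 : U - s * U / (s + 1) <= B * E.
  have -> : U - s * U / (s + 1) = U / (s + 1) by field; rewrite gt_eqF.
  by rewrite ler_pdivrMr.
have h6 : M / 2 * s * nsq d <= M / 2 * L * enorm d.
  have -> : M / 2 * s * nsq d = M / 2 * (s * enorm d) * enorm d by rewrite -sqr_enorm; ring.
  by rewrite (ler_wpM2r (ltW ed))// ler_wpM2l// divr_ge0.
lra.
Qed.

Lemma envelope_holder x y :
  `|envelope x - envelope y| <= B * enorm (x - y) `^ g + M / 2 * L * enorm (x - y).
Proof.
have eC z z' : enorm (z - z') = enorm (z' - z) by rewrite -opprB enormN.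
have pos z : 0 <= B * enorm z `^ g /\ 0 <= M / 2 * L * enorm z.
  by split; rewrite mulr_ge0 ?powR_ge0 ?enorm_ge0// mulr_ge0// divr_ge0.
have side z z' : A z -> ~ A z' ->
  `|envelope z - envelope z'| <= B * enorm (z - z') `^ g + M / 2 * L * enorm (z - z').
  move=> Az nAz'; rewrite (envelope_out nAz') subr0 ler_norml.
  have [p1 p2] := pos (z - z'); apply/andP; split.
    have := @envelope_ge z (z' - z) Az; rewrite [z + _]addrC subrK (eC z' z) => /(_ nAz').
    by apply: le_trans; rewrite lerN2 lerDr.
  by apply: le_trans (ub Az nAz') _; rewrite lerDl.
have [Ax|nAx] := pselect (A x); have [Ay|nAy] := pselect (A y).
- have [->|xy] := eqVneq x y.
    by rewrite [envelope y - _]subrr normr0; have [p1 p2] := pos (y - y); rewrite addr_ge0.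
  rewrite ler_norml; apply/andP; split.
    by rewrite lerNl opprB eC envelope_increment.
  by rewrite envelope_increment// eq_sym.
- exact: side.
- by rewrite distrC eC; exact: side.
- by rewrite !envelope_out// subrr normr0; have [p1 p2] := pos (x - y); rewrite addr_ge0.
Qed.

Lemma envelope_continuous : continuous envelope.
Proof.
move=> x; apply/cont_epsP => e e0.
have /andP[g0 g1] := g01.
have NL : 0 <= M / 2 * L by rewrite mulr_ge0// divr_ge0.
pose K := B + M / 2 * L + 1.
have K0 : 0 < K by rewrite ltr_wpDl// addr_ge0.
have Np : 0 < N%:R :> R by rewrite ltr0n.
pose r := Num.min 1 ((e / K) `^ g^-1).
have eK : 0 < e / K by rewrite divr_gt0.
have r0 : 0 < r by rewrite lt_min ltr01 powR_gt0.
exists (r / N%:R) => [|z zx]; first by rewrite divr_gt0.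
have hr : enorm (z - x) < r.
  by apply: le_lt_trans (enorm_le_norm _) _; rewrite mulrC -ltr_pdivlMr.
apply: le_lt_trans (envelope_holder z x) _.
move: hr; rewrite lt_min => /andP[h1 h2].
set h := enorm (z - x) in h1 h2 *.
have h0 : 0 <= h by exact: enorm_ge0.
have hg : h `^ g < e / K.
  have : h `^ g < ((e / K) `^ g^-1) `^ g by rewrite gt0_ltr_powR// nnegrE// powR_ge0.
  by rewrite -powRrM mulVf ?lt0r_neq0// powRr1// ltW.
have hh : h <= h `^ g.
  have [->|hn0] := eqVneq h 0; first exact: powR_ge0.
  have hp : 0 < h by rewrite lt_neqAle eq_sym hn0.
  by rewrite ger1_powR// hp ltW.
have hgg := powR_ge0 h g.
apply: le_lt_trans (_ : K * h `^ g < _).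
  rewrite /K !mulrDl mul1r -addrA lerD2l (@le_trans _ _ (M / 2 * L * h `^ g))//.
    by rewrite ler_wpM2l.
  by rewrite lerDl.
by rewrite -ltr_pdivlMl// mulrC.
Qed.

End Envelope.
Section PerronViscosity.
Variables (R : realType) (N : nat).
Implicit Types (x y z d : 'cV[R]_N) (A : set 'cV[R]_N) (f w u psi : 'cV[R]_N -> R).

Lemma supersol_sdiff A f w x d m : supersol A f w ->
  (forall t, `|t| < 1 -> A (x + t *: d) /\ f (x + t *: d) <= m) ->
  sdiff w x d <= m * nsq d.
Proof.
move=> ws H.
have ba : (x + d) - (x - d) = 2 *: d by apply/colP => i; rewrite !mxE; ring.
have pE t : (x - d) + t *: ((x + d) - (x - d)) = x + (2 * t - 1) *: d.
  by apply/colP => i; rewrite !mxE; ring.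
have h2 : 2^-1 * 2 = 1 :> R by rewrite mulVf.
have := ws (x - d) (x + d) m _ 2^-1 _; rewrite pE ba nsqZ mulfV// subrr scale0r addr0.
move=> h; have {h} := h _ _; rewrite /sdiff.
suff [h3 h4] : (forall t, 0 < t < 1 -> A (x - d + t *: (2 *: d)) /\ f (x - d + t *: (2 *: d)) <= m) /\ (0 < 2^-1 :> R) && (2^-1 < 1 :> R).
  by move=> /(_ h3 h4); lra.
split; last by lra.
move=> t /andP[t0 t1]; rewrite -ba pE; apply: H.
by rewrite ltr_norml; apply/andP; split; lra.
Qed.

Lemma supersol_sdiff_near A f w x : open A -> supersol A f w -> A x ->
  {for x, continuous f} -> forall e, 0 < e -> exists2 r, 0 < r &
  forall d, `|d| < r -> sdiff w x d <= (f x + e) * nsq d.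
Proof.
move=> oA ws Ax /cont_epsP cf e e0.
have [r1 r10 H1] := open_norm oA Ax; have [r2 r20 H2] := cf e e0.
exists (Num.min r1 r2); first by rewrite lt_min r10.
move=> d; rewrite lt_min => /andP[d1 d2]; apply: supersol_sdiff ws _ => t t1.
have hd r : `|d| < r -> `|x + t *: d - x| < r.
  move=> dr; rewrite addrC addKr normrZ; apply: le_lt_trans dr.
  by rewrite ler_piMl// ltW.
split; first exact: H1 (hd _ d1).
by have := H2 _ (hd _ d2) => /ltW; rewrite ler_distl => /andP[].
Qed.

Lemma supersol_viscosity A f w psi x : (0 < N)%N -> open A -> supersol A f w ->
  {for x, continuous f} -> C2_on A psi -> A x ->
  is_local_min (fun z => w z - psi z) x -> P1plus (hessian psi x) <= f x.
Proof.
move=> N0 oA ws cf pC2 Ax /norm_near[r1 r10 H1].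
apply: (P1plus_hessian_le N0 oA pC2 Ax) => e e0.
have [r2 r20 H2] := supersol_sdiff_near oA ws Ax cf e0.
exists (Num.min r1 r2) => [|d]; first by rewrite lt_min r10.
rewrite lt_min => /andP[d1 d2]; apply: le_trans (H2 d d2).
have h1 := H1 (x + d); rewrite [x + d - x]addrC addKr in h1.
have h2 := H1 (x - d); rewrite [x - d - x]addrC addKr normrN in h2.
by have := h1 d1; have := h2 d1; rewrite /sdiff /=; lra.
Qed.

Lemma sdiff_nsq x0 z d : sdiff (fun z => nsq (z - x0)) z d = 2 * nsq d.
Proof.
rewrite /sdiff.
have -> : z + d - x0 = (z - x0) + d by rewrite addrAC.
have -> : z - d - x0 = (z - x0) - d by rewrite addrAC.
move: (z - x0) => y; by rewrite !nsqE !dotE (dotC d y); ring.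
Qed.

Lemma cont_eq_near (g h : 'cV[R]_N -> R) x r : 0 < r ->
  (forall z, `|z - x| < r -> g z = h z) ->
  {for x, continuous h} -> {for x, continuous g}.
Proof.
move=> r0 E /cont_epsP ch; apply/cont_epsP => e /ch[r1 r10 H].
exists (Num.min r r1) => [|z]; first by rewrite lt_min r0.
rewrite lt_min => /andP[z1 z2]; rewrite !E ?subrr ?normr0//; exact: H.
Qed.

(* If the subsolution inequality failed at [x0], the minimum of [u] and of [psi]
   (raised quadratically away from [x0] and lowered by [eta]) near [x0] would be a
   smaller element of the class. *)
Lemma minimal_supersol_viscosity A f u psi x0 : (0 < N)%N -> open A ->
  C0_on A f -> zero_supersol A f u ->
  (forall w, zero_supersol A f w -> forall x, u x <= w x) -> continuous u ->
  C2_on A psi -> A x0 -> is_local_max (fun z => u z - psi z) x0 ->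
  f x0 <= P1plus (hessian psi x0).
Proof.
move=> N0 oA fc [us u0] umin uc pC2 Ax0 /norm_near[r1 r10 H1].
rewrite leNgt; apply/negP => Pf; set P := P1plus _ in Pf.
pose th := (f x0 - P) / 4.
have th0 : 0 < th by rewrite divr_gt0// subr_gt0.
have Pth : f x0 = P + 4 * th by rewrite /th; field.
have [r2 r20 H2] := open_norm oA Ax0.
have /cont_epsP /(_ th th0) [r3 r30 H3] := fc x0 Ax0.
have [r4 r40 H4] := sdiff_le_P1plus N0 oA pC2 Ax0 th0.
pose r := Num.min (Num.min r1 r2) (Num.min r3 r4).
have r0 : 0 < r by rewrite !lt_min r10 r20 r30 r40.
have rr : r <= r1 /\ r <= r2 /\ r <= r3 /\ r <= r4.
  by rewrite /r !ge_min !lexx !orbT.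
clearbody r; case: rr => rr1 [rr2 [rr3 rr4]].
pose eta := th * r ^+ 2 / 16.
have eta0 : 0 < eta by rewrite divr_gt0// mulr_gt0// exprn_gt0.
pose q z := psi z + (u x0 - psi x0) + th / 2 * nsq (z - x0) - eta.
pose v z := if `|z - x0| < r then Num.min (u z) (q z) else u z.
have vu z : v z <= u z by rewrite /v; case: ifP => // _; rewrite ge_min lexx.
have vq z : `|z - x0| < r -> v z <= q z by rewrite /v => ->; rewrite ge_min lexx orbT.
have uq z : `|z - x0| < r -> r / 2 <= `|z - x0| -> u z <= q z.
  move=> zr rz; have := H1 z (lt_le_trans zr rr1) => /= h.
  have : r ^+ 2 / 4 <= nsq (z - x0).
    have -> : r ^+ 2 / 4 = (r / 2) ^+ 2 by field.
    rewrite -sqr_enorm ler_sqr ?nnegrE ?enorm_ge0 ?divr_ge0//; last exact: ltW.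
    exact: le_trans rz (norm_le_enorm _).
  rewrite -(ler_pM2l th0) => h2.
  by rewrite /q /eta; have := mulr_gt0 th0 (exprn_gt0 2 r0); lra.
have vE z : r / 2 <= `|z - x0| -> v z = u z.
  move=> rz; rewrite /v; case: ifP => // zr.
  by apply/min_idPl; exact: uq.
have far x z : r <= `|x - x0| -> `|z - x| < r / 2 -> r / 2 <= `|z - x0|.
  move=> h1 h2; have := ler_normB (z - x0) (z - x).
  have -> : z - x0 - (z - x) = x - x0 by apply/colP => i; rewrite !mxE; ring.
  by lra.
have vW : zero_supersol A f v.
  split; last first.
    move=> x nAx; rewrite /v ifF ?u0//; apply/negbTE/negP => xr.
    by apply/nAx/H2/(lt_le_trans xr).
  apply: supersol_pointwise.
  - move=> x Ax; have [xr|rx] := ltP `|x - x0| r; last first.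
      apply: (@cont_eq_near _ u x (r / 2)); [exact: divr_gt0|move=> z zx|exact: uc].
      by apply: vE; exact: far zx.
    apply: (@cont_eq_near _ (fun z => Num.min (u z) (q z)) x (r - `|x - x0|)).
    + by rewrite subr_gt0.
    + move=> z zx; rewrite /v ifT// -[z](subrK x) -addrA.
      by rewrite (le_lt_trans (ler_normD _ _))// -ltrBrDr.
    + have cq : {for x, continuous q}.
        have cn : {for x, continuous (fun z => th / 2 * nsq (z - x0))}.
          apply: cont_mul; first exact: cont_cst.
          rewrite (_ : (fun z => _) = fun z => dot (z - x0) (z - x0)); last exact/funext/(fun z => nsqE _).
          have cs : {for x, continuous (fun z : 'cV[R]_N => z - x0)}.
            by apply: cont_cV => i; rewrite (_ : (fun z => _) = fun z : 'cV[R]_N => z i ord0 - x0 i ord0);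
              [apply: cont_sub; [exact: coord_continuous|exact: cont_cst]|apply/funext => z; rewrite coordB].
          by apply: cont_dot.
        apply: cont_sub; last exact: cont_cst.
        apply: cont_add cn; apply: cont_add; last exact: cont_cst.
        exact: pC2.1.1 Ax.
      by apply: cont_min cq; exact: uc.
  - move=> x nAx; apply: cont_lsc.
    apply: (@cont_eq_near _ u x (r / 2)); [exact: divr_gt0|move=> z zx|exact: uc].
    apply: vE; apply: far zx; rewrite leNgt; apply/negP => xr.
    by apply/nAx/H2/(lt_le_trans xr).
  - move=> x Ax e e0; have [vx|/eqP vx] := eqVneq (v x) (u x).
      have [s s0 H5] := supersol_sdiff_near oA us Ax (fc x Ax) e0.
      exists s => // d /H5; apply: le_trans.
      by have := vu (x + d); have := vu (x - d); rewrite /sdiff vx; lra.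
    have xr : `|x - x0| < r / 2 by rewrite ltNge; apply/negP => /vE.
    have xr' : `|x - x0| < r by apply: lt_trans xr _; rewrite ltr_pdivrMr// ltr_pMr ?ltr1n.
    have vqx : v x = q x.
      by move: vx; rewrite /v xr'; case: (leP (u x) (q x)).
    exists (r / 2) => [|d dr]; first exact: divr_gt0.
    have xd d' : `|d'| < r / 2 -> `|x + d' - x0| < r.
      move=> h; rewrite addrAC (le_lt_trans (ler_normD _ _))//.
      by rewrite [r]splitr ltrD.
    have h1 := vq _ (xd d dr); have h2 : v (x - d) <= q (x - d) by apply: vq; apply: xd; rewrite normrN.
    have h3 : sdiff q x d = sdiff psi x d + th / 2 * (2 * nsq d).
      by rewrite -(sdiff_nsq x0 x d) /sdiff /q; ring.
    have dr' : `|d| < r4.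
      apply: lt_le_trans rr4; apply: lt_trans dr _.
      by rewrite ltr_pdivrMr// ltr_pMr ?ltr1n.
    have h4 := H4 x d (lt_le_trans xr' rr4) dr'.
    have h5 := H3 x (lt_le_trans xr' rr3); move: h5 => /ltW; rewrite ler_distl => /andP[h5 _].
    have n0 := nsq_ge0 d.
    apply: le_trans (_ : sdiff q x d <= _).
      by rewrite /sdiff vqx; lra.
    rewrite h3; apply: le_trans (_ : (P + th + th) * nsq d <= _).
      by move: h4; rewrite -/P; lra.
    by rewrite ler_wpM2r//; lra.
have := umin v vW x0; rewrite /v subrr normr0 r0 /q subrr.
have -> : nsq (0 : 'cV[R]_N) = 0 by rewrite -(scale0r 0) nsqZ expr0n mul0r.
by rewrite le_min => /andP[_]; lra.
Qed.

End PerronViscosity.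
Section UniformContinuity.
Variables (R : realType) (V : normedModType R).

Lemma compact_unif_cont (w : V -> R) (K : set V) : continuous w -> compact K ->
  forall e, 0 < e -> exists2 r, 0 < r &
    forall y z, K y -> `|z - y| < r -> `|w z - w y| < e.
Proof.
move=> cw /compact_near_coveringP cK e e0.
have e2 : 0 < e / 2 by rewrite divr_gt0.
have := cK R (0 : R)^'+ (fun r y => forall z, `|z - y| < r -> `|w z - w y| < e) _ _.
case=> [x Kx|r /= r0 H].
  have /cont_epsP /(_ _ e2) [d d0 Hd] := cw x.
  have d2 : 0 < d / 2 by rewrite divr_gt0.
  exists (ball x (d / 2), [set r | r < d / 2]) => /=.
    by split; [exact: nbhsx_ballx|exact: nbhs_right_lt].
  move=> [y r] /= [xy rd] z zy.
  have xy' : `|y - x| < d / 2 by rewrite distrC; move: xy; rewrite -ball_normE.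
  have h1 : `|w y - w x| < e / 2 by apply: Hd; lra.
  have h2 : `|w z - w x| < e / 2.
    apply: Hd; rewrite -[z](subrK y) -addrA (le_lt_trans (ler_normD _ _))//; lra.
  have -> : w z - w y = (w z - w x) - (w y - w x) by ring.
  by rewrite (le_lt_trans (ler_normB _ _))//; lra.
exists (r / 2) => [|y z Ky zy]; first by rewrite divr_gt0.
apply: (H (r / 2)) => //=; last by rewrite divr_gt0.
by rewrite sub0r normrN gtr0_norm ?divr_gt0// ltr_pdivrMr// ltr_pMr ?ltr1n.
Qed.

End UniformContinuity.

Section Mean.
Variable R : realType.
Implicit Types (phi psi P : R -> R) (h t : R).

Lemma derive1_is_derive (F : R -> R) t (l : R) : derivable F t (1 : R) -> derive1 F t = l ->
  is_derive t (1 : R) F l.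
Proof. by move=> dF Fl; apply: DeriveDef => //; rewrite -derive1E. Qed.

Lemma primitive_exists phi (T : R) : continuous phi -> 0 < T ->
  exists P, forall t : R, `|t| < T -> is_derive t (1 : R) P (phi t).
Proof.
move=> cphi T0.
have ic : lebesgue_measure.-integrable `[- T, T] (EFin \o phi).
  apply: continuous_compact_integrable; first exact: segment_compact.
  exact: continuous_subspaceT.
exists (fun x => Rintegral lebesgue_measure `[- T, x] phi) => t.
rewrite ltr_norml => /andP[t1 t2].
have [dP PE] := @continuous_FTC1_closed R phi (- T) t T t2 ic t1 (cphi t).
exact: derive1_is_derive dP PE.
Qed.

(* The average of [phi] over [[- h, h]].  It is specified through an arbitrary
   primitive, so that shifts and derivatives are read off primitives without any
   change of variables. *)
Definition mean h phi : R := xget 0 [set m | exists2 P,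
  (forall t : R, `|t| <= h -> is_derive t (1 : R) P (phi t)) &
  m = (P h - P (- h)) / (2 * h)].

Lemma primitive_increment h phi P Q : 0 < h ->
  (forall t : R, `|t| <= h -> is_derive t (1 : R) P (phi t)) ->
  (forall t : R, `|t| <= h -> is_derive t (1 : R) Q (phi t)) ->
  P h - P (- h) = Q h - Q (- h).
Proof.
move=> h0 dP dQ.
have D t : `|t| <= h -> P t - Q t = P 0 - Q 0.
  move=> th; have [s st|s _] := @mvt_sym R (fun t => P t - Q t) (fun=> 0) t.
    have hs := le_trans st th.
    by apply: is_derive_eq (is_deriveB (dP s hs) (dQ s hs)) _; rewrite subrr.
  by rewrite mulr0 => /eqP; rewrite subr_eq0 => /eqP.
have h1 : `|h| <= h by rewrite gtr0_norm.
have h2 : `|- h| <= h by rewrite normrN.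
by have := D _ h1; have := D _ h2; lra.
Qed.

Lemma meanE h phi P : 0 < h ->
  (forall t : R, `|t| <= h -> is_derive t (1 : R) P (phi t)) ->
  mean h phi = (P h - P (- h)) / (2 * h).
Proof.
move=> h0 dP; rewrite /mean; case: xgetP => [m _ [Q dQ ->]|/(_ ((P h - P (- h)) / (2 * h)))].
  by rewrite (primitive_increment h0 dQ dP).
by move=> H; exfalso; apply: H; exists P.
Qed.

Lemma mean_prim h phi : 0 < h -> continuous phi -> exists2 P,
  (forall t : R, `|t| <= h -> is_derive t (1 : R) P (phi t)) &
  mean h phi = (P h - P (- h)) / (2 * h).
Proof.
move=> h0 cphi; have [|P dP] := @primitive_exists phi (2 * h) cphi; first by rewrite mulr_gt0.
have dP' (t : R) : `|t| <= h -> is_derive t (1 : R) P (phi t).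
  by move=> th; apply: dP; apply: le_lt_trans th _; rewrite ltr_pMl// ltr1n.
by exists P => //; exact: meanE.
Qed.

Lemma mean_value h phi : 0 < h -> continuous phi ->
  exists2 s, `|s| <= h & mean h phi = (phi s + phi (- s)) / 2.
Proof.
move=> h0 cphi; have [P dP ->] := mean_prim h0 cphi.
have [s sh|s sh E] := @mvt_sym R (fun t => P t - P (- t)) (fun t => phi t + phi (- t)) h.
  rewrite (gtr0_norm h0) in sh; have hN : `|- s| <= h by rewrite normrN.
  have h3 : is_derive s (1 : R) (fun t => P (- t)) (phi (- s) * -1).
    by have := dP _ hN => ?; apply: (@is_derive1_comp _ P -%R s).
  by apply: is_derive_eq (is_deriveB (dP s sh) h3) _; rewrite mulrN1 opprK.
rewrite (gtr0_norm h0) in sh; exists s => //.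
move: E; rewrite oppr0 subrr subr0 => ->; field.
by rewrite gt_eqF.
Qed.

Lemma mean_lin h phi psi a : 0 < h -> continuous phi -> continuous psi ->
  mean h (fun t => a * phi t + psi t) = a * mean h phi + mean h psi.
Proof.
move=> h0 cphi cpsi.
have [P dP ->] := mean_prim h0 cphi; have [Q dQ ->] := mean_prim h0 cpsi.
have dR (t : R) : `|t| <= h ->
    is_derive t (1 : R) (fun t => a * P t + Q t) (a * phi t + psi t).
  by move=> th; exact: is_deriveD (@is_deriveZ _ _ _ _ a _ _ _ (dP t th)) (dQ t th).
by rewrite (meanE h0 dR); ring.
Qed.

End Mean.

Section LinearCombination.
Variables (R : realType) (V : normedModType R).

Lemma continuous_lin (f g : V -> R) a : continuous f -> continuous g ->
  continuous (fun z => a * f z + g z).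
Proof.
move=> cf cg z; apply: (@cont_add R V (fun z => a * f z) g z); last exact: cg.
by apply: (@cont_mul R V (fun=> a) f z); [exact: cont_cst|exact: cf].
Qed.

End LinearCombination.

Section Steklov.
Variables (R : realType) (N : nat) (h : R).
Hypothesis h0 : 0 < h.
Implicit Types (x y z d v : 'cV[R]_N) (w g : 'cV[R]_N -> R) (i : 'I_N).

Definition steklov i w x : R := mean h (fun t => w (x + t *: unitv R i)).

Lemma cont_line w x v : continuous w -> continuous (fun t : R => w (x + t *: v)).
Proof.
move=> cw t; apply: (@continuous_comp _ _ _ (fun t : R => x + t *: v) w); last exact: cw.
by apply: cvgD; [exact: cvg_cst|apply: cvgZl; exact: cvg_id].
Qed.

Lemma steklov_value i w x : continuous w -> exists2 s, `|s| <= h &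
  steklov i w x = (w (x + s *: unitv R i) + w (x - s *: unitv R i)) / 2.
Proof.
move=> cw; have [s sh E] := mean_value h0 (@cont_line w x (unitv R i) cw).
by exists s => //; rewrite /steklov E scaleNr.
Qed.

Lemma steklov_lin i w g a x : continuous w -> continuous g ->
  steklov i (fun z => a * w z + g z) x = a * steklov i w x + steklov i g x.
Proof. by move=> cw cg; apply: mean_lin h0 _ _; exact: cont_line. Qed.

Lemma steklov_shift i w x d :
  steklov i (fun z => w (z + d)) x = steklov i w (x + d).
Proof. by congr mean; apply/funext => t; rewrite addrAC. Qed.

Lemma cont_shift w d : continuous w -> continuous (fun z => w (z + d)).
Proof.
move=> cw x; apply/cont_epsP => e e0; have /cont_epsP /(_ e e0) [r r0 H] := cw (x + d).
by exists r => // z zx; apply: H; rewrite opprD addrACA subrr addr0.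
Qed.

Lemma steklov_unif i w x K : continuous w -> (forall z, `|z - x| <= h -> `|w z| <= K) ->
  `|steklov i w x| <= K.
Proof.
move=> cw wK; have [s sh ->] := steklov_value i x cw.
have hs t : `|t| <= h -> `|x + t *: unitv R i - x| <= h.
  by move=> th; rewrite addrC addKr normrZ; apply: le_trans th; rewrite ler_piMr// normr_unitv.
rewrite -scaleNr normrM [`|2^-1|]ger0_norm// ler_pdivrMr// (le_trans (ler_normD _ _))//.
by rewrite mulr_natr mulr2n lerD// wK// hs// normrN.
Qed.

Lemma steklov_diff_le i w g x x' K : continuous w -> continuous g ->
  (forall t, `|t| <= h -> `|w (x' + t *: unitv R i) - g (x + t *: unitv R i)| <= K) ->
  `|steklov i w x' - steklov i g x| <= K.
Proof.
move=> cw cg wK.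
have c1 : continuous (fun z => -1 * g z + w (z + (x' - x))).
  by apply: continuous_lin => //; exact: cont_shift.
have E : steklov i w x' - steklov i g x = steklov i (fun z => -1 * g z + w (z + (x' - x))) x.
  rewrite steklov_lin//; last exact: cont_shift.
  by rewrite steklov_shift [x + _]addrC subrK mulN1r addrC.
rewrite E; have [s sh ->] := steklov_value i x c1.
have K1 t : `|t| <= h -> `|-1 * g (x + t *: unitv R i) + w (x + t *: unitv R i + (x' - x))| <= K.
  move=> /wK; rewrite mulN1r [- _ + _]addrC.
  by have -> : x + t *: unitv R i + (x' - x) = x' + t *: unitv R i by rewrite addrC addrA subrK.
rewrite -scaleNr normrM [`|2^-1|]ger0_norm// ler_pdivrMr// (le_trans (ler_normD _ _))//.
by rewrite mulr_natr mulr2n lerD// K1// normrN.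
Qed.

Lemma steklov_continuous i w : continuous w -> continuous (steklov i w).
Proof.
move=> cw x; apply/cont_epsP => e e0; have e2 : 0 < e / 2 by rewrite divr_gt0.
have [r r0 H] := compact_unif_cont cw (@compact_closed_ball R N x h) e2.
exists r => // z zx; apply: (@le_lt_trans _ _ (e / 2)); last by rewrite ltr_pdivrMr// ltr_pMr ?ltr1n.
apply: steklov_diff_le => // t th; apply/ltW/H => /=.
  by rewrite addrC addKr normrZ; apply: le_trans th; rewrite ler_piMr// normr_unitv.
by rewrite opprD addrACA subrr addr0.
Qed.

Lemma steklov_derive i w x : continuous w -> is_derive x (unitv R i) (steklov i w)
  ((w (x + h *: unitv R i) - w (x - h *: unitv R i)) / (2 * h)).
Proof.
move=> cw; pose phi t := w (x + t *: unitv R i).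
have cphi : continuous phi by exact: cont_line.
have [|P dP] := @primitive_exists _ phi (2 * h) cphi; first by rewrite mulr_gt0.
have SE s : `|s| < h -> steklov i w (x + s *: unitv R i) = (P (s + h) - P (s - h)) / (2 * h).
  move=> sh.
  have dPs (t : R) : `|t| <= h -> is_derive t (1 : R) (fun t => P (s + t)) (w (x + s *: unitv R i + t *: unitv R i)).
    move=> th; rewrite -addrA -scalerDl.
    have hst : `|s + t| < 2 * h by rewrite (le_lt_trans (ler_normD _ _))// mulr2n mulrDl mul1r ltr_leD.
    have := dP _ hst; rewrite -/(phi (s + t)).
    move/is_derive_epsP => H; apply/is_derive_epsP => e e0; have [r r0 {}H] := H e e0.
    by exists r => // k kr; have := H k kr; rewrite addrA.
  exact: (meanE h0 dPs).
have h2 : `|h| < 2 * h by rewrite gtr0_norm// ltr_pMl// ltr1n.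
have h2' : `|- h| < 2 * h by rewrite normrN.
have /is_derive_epsP d1 := dP _ h2; have /is_derive_epsP d2 := dP _ h2'.
apply/is_derive_epsP => e e0; have eh : 0 < e * h by rewrite mulr_gt0.
have [r1 r10 H1] := d1 _ eh; have [r2 r20 H2] := d2 _ eh.
exists (Num.min h (Num.min r1 r2)) => [|k]; first by rewrite !lt_min h0 r10.
rewrite !lt_min => /and3P[kh kr1 kr2].
have S0 : steklov i w x = (P h - P (- h)) / (2 * h).
  by have := SE 0; rewrite normr0 scale0r addr0 add0r sub0r; apply.
rewrite SE// S0.
have l1 : `|P (k + h) - P h - k * w (x + h *: unitv R i)| <= e * h * `|k|.
  by have := H1 k kr1; rewrite [k *: 1]mulr1 [h + k]addrC.
have l2 : `|P (k - h) - P (- h) - k * w (x - h *: unitv R i)| <= e * h * `|k|.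
  by have := H2 k kr2; rewrite [k *: 1]mulr1 [- h + k]addrC /phi scaleNr.
have alg (a b c dd p q : R) : (a - c) / (2 * h) - (b - dd) / (2 * h) - k * ((p - q) / (2 * h)) =
  ((a - b - k * p) - (c - dd - k * q)) / (2 * h) by ring.
rewrite alg.
have hh : 0 < 2 * h by rewrite mulr_gt0.
rewrite normrM normfV (gtr0_norm hh) ler_pdivrMr// (le_trans (ler_normB _ _))//.
by move: l1 l2; lra.
Qed.

Lemma steklov_derive_inside i w w' v : continuous w -> continuous w' ->
  (forall x, is_derive x v w (w' x)) ->
  forall x, is_derive x v (steklov i w) (steklov i w' x).
Proof.
move=> cw cw' dw x; apply/is_derive_epsP => e e0.
have [r r0 H] := compact_unif_cont cw' (@compact_closed_ball R N x h) e0.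
have v1 : 0 < `|v| + 1 by rewrite ltr_wpDl.
exists (r / (`|v| + 1)) => [|k kr]; first by rewrite divr_gt0.
have kv : `|k| * `|v| < r.
  rewrite ltr_pdivlMr// in kr; apply: le_lt_trans kr.
  by rewrite ler_wpM2l// lerDl.
have c1 : continuous (fun z => -1 * w z + w (z + k *: v)).
  by apply: continuous_lin => //; exact: cont_shift.
have -> : steklov i w (x + k *: v) - steklov i w x - k * steklov i w' x =
   steklov i (fun z => - k * w' z + (-1 * w z + w (z + k *: v))) x.
  rewrite steklov_lin// steklov_lin//; last exact: cont_shift.
  by rewrite steklov_shift; ring.
apply: steklov_unif => [|z zx]; first exact: continuous_lin.
have [s sk E] := @mvt_dir _ _ w z v k w'.
have -> : - k * w' z + (-1 * w z + w (z + k *: v)) = k * (w' (z + s *: v) - w' z).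
  by rewrite mulrBr -E; ring.
rewrite normrM mulrC ler_wpM2r//; apply/ltW/H => //.
by rewrite addrC addKr normrZ; apply: le_lt_trans kv; rewrite ler_wpM2r.
Qed.

End Steklov.
Section GlobalC2.
Variables (R : realType) (N : nat).
Implicit Types (x y z d v : 'cV[R]_N) (w g : 'cV[R]_N -> R) (i : 'I_N).

Definition C1g g : Prop := continuous g /\ forall i, exists2 g',
  continuous g' & forall x, is_derive x (unitv R i) g (g' x).

Definition C2g g : Prop := continuous g /\ forall i, exists2 g',
  C1g g' & forall x, is_derive x (unitv R i) g (g' x).

Lemma C2g_C1g g : C2g g -> C1g g.
Proof. by move=> [cg dg]; split=> // i; have [g' [cg' _] Hg'] := dg i; exists g'. Qed.

Lemma partial_eq g g' i : (forall x, is_derive x (unitv R i) g (g' x)) -> partial i g = g'.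
Proof. by move=> H; apply/funext => x; have := H x => h; rewrite /partial; exact: derive_val. Qed.

Lemma C1g_C1_on A g : C1g g -> C1_on A g.
Proof.
move=> [cg dg]; split=> [x _|i]; first exact: cg.
have [g' cg' Hg'] := dg i; split=> x _; first exact: ex_derive.
by rewrite (partial_eq Hg'); exact: cg'.
Qed.

Lemma C2g_C2_on A g : C2g g -> C2_on A g.
Proof.
move=> gC2; split=> [|i]; first exact/C1g_C1_on/C2g_C1g.
by have [g' g'C1 Hg'] := gC2.2 i; rewrite (partial_eq Hg'); exact: C1g_C1_on.
Qed.

Lemma C1g_cst (a : R) : C1g (fun=> a).
Proof.
split=> [x|i]; first exact: cont_cst.
by exists (fun=> 0) => x; [exact: cont_cst|exact: is_derive_cst].
Qed.

Lemma C2g_cst (a : R) : C2g (fun=> a).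
Proof.
split=> [x|i]; first exact: cont_cst.
by exists (fun=> 0) => [|x]; [exact: C1g_cst|exact: is_derive_cst].
Qed.

Lemma C1g_add f g : C1g f -> C1g g -> C1g (fun z => f z + g z).
Proof.
move=> [cf df] [cg dg]; split=> [x|i]; first exact: cont_add (cf x) (cg x).
have [f' cf' Hf] := df i; have [g' cg' Hg] := dg i.
exists (fun z => f' z + g' z) => x; first exact: cont_add (cf' x) (cg' x).
exact: is_deriveD (Hf x) (Hg x).
Qed.

Lemma C2g_add f g : C2g f -> C2g g -> C2g (fun z => f z + g z).
Proof.
move=> [cf df] [cg dg]; split=> [x|i]; first exact: cont_add (cf x) (cg x).
have [f' cf' Hf] := df i; have [g' cg' Hg] := dg i.
exists (fun z => f' z + g' z) => [|x]; first exact: C1g_add.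
exact: is_deriveD (Hf x) (Hg x).
Qed.

Lemma is_derive_mul f g x v (f' g' : R) : is_derive x v f f' -> is_derive x v g g' ->
  is_derive x v (fun z => f z * g z) (f' * g x + f x * g').
Proof.
move=> df dg; apply: is_derive_eq (is_deriveM df dg) _.
by rewrite /GRing.scale /=; ring.
Qed.

Lemma C1g_mul f g : C1g f -> C1g g -> C1g (fun z => f z * g z).
Proof.
move=> [cf df] [cg dg]; split=> [x|i]; first exact: cont_mul (cf x) (cg x).
have [f' cf' Hf] := df i; have [g' cg' Hg] := dg i.
exists (fun z => f' z * g z + f z * g' z) => x.
  exact: cont_add (cont_mul (cf' x) (cg x)) (cont_mul (cf x) (cg' x)).
exact: is_derive_mul.
Qed.

Lemma C2g_mul f g : C2g f -> C2g g -> C2g (fun z => f z * g z).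
Proof.
move=> fC gC; have [cf df] := fC; have [cg dg] := gC.
split=> [x|i]; first exact: cont_mul (cf x) (cg x).
have [f' cf' Hf] := df i; have [g' cg' Hg] := dg i.
exists (fun z => f' z * g z + f z * g' z) => [|x]; last exact: is_derive_mul.
by apply: C1g_add; apply: C1g_mul => //; exact: C2g_C1g.
Qed.

Lemma C2g_coord i : C2g (fun z : 'cV[R]_N => z i ord0).
Proof.
split=> [x|j]; first exact: coord_continuous.
exists (fun=> (i == j)%:R) => [|x]; first exact: C1g_cst.
apply/is_derive_epsP => e e0; exists 1 => // k _.
rewrite [X in `|X|](_ : _ = 0); first by rewrite normr0 mulr_ge0// ltW.
by rewrite !mxE eqxx andbT; ring.
Qed.

Lemma C2g_sum (I : Type) (r : seq I) (F : I -> 'cV[R]_N -> R) :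
  (forall k, C2g (F k)) -> C2g (fun z => \sum_(k <- r) F k z).
Proof.
move=> H; elim: r => [|i r IH].
  by rewrite (_ : (fun z => _) = fun=> 0); [exact: C2g_cst|apply/funext => z; rewrite big_nil].
rewrite (_ : (fun z => _) = fun z => F i z + \sum_(j <- r) F j z); first exact: C2g_add.
by apply/funext => z; rewrite big_cons.
Qed.

Lemma C2g_dot x d : C2g (fun z => dot (z - x) d).
Proof.
apply: C2g_sum => i; rewrite (_ : (fun z => _) = fun z : 'cV[R]_N => (z i ord0 + - x i ord0) * d i ord0).
  by apply: C2g_mul (C2g_cst _); apply: C2g_add (C2g_coord i) (C2g_cst _).
by apply/funext => z; rewrite coordB.
Qed.

Lemma C2g_nsq x : C2g (fun z => nsq (z - x)).
Proof.
apply: C2g_sum => i; rewrite (_ : (fun z => _) = fun z : 'cV[R]_N => (z i ord0 + - x i ord0) * (z i ord0 + - x i ord0)).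
  by apply: C2g_mul; apply: C2g_add (C2g_coord i) (C2g_cst _).
by apply/funext => z; rewrite coordB expr2.
Qed.

Section Smoothing.
Variable h : R.
Hypothesis h0 : 0 < h.

Definition smooth_in (l : seq 'I_N) w := foldr (fun i u => steklov h i u) w l.

Lemma smooth_in_continuous l w : continuous w -> continuous (smooth_in l w).
Proof. by move=> cw; elim: l => //= i l IH; exact: steklov_continuous. Qed.

Lemma smooth_in_derive l w w' v : continuous w -> continuous w' ->
  (forall x, is_derive x v w (w' x)) ->
  forall x, is_derive x v (smooth_in l w) (smooth_in l w' x).
Proof.
move=> cw cw' dw; elim: l => //= i l IH.
by apply: steklov_derive_inside => //; exact: smooth_in_continuous.
Qed.

(* Averaging in direction [i] gains one derivative in that direction and keeps
   those already available in the others. *)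
Lemma smooth_in_C1 l w : continuous w -> forall i, i \in l -> exists2 g',
  continuous g' & forall x, is_derive x (unitv R i) (smooth_in l w) (g' x).
Proof.
move=> cw; elim: l => //= j l IH i; have cl := @smooth_in_continuous l w cw.
rewrite inE => /orP[/eqP ->|/IH[g' cg' Hg']].
  exists (fun x => (smooth_in l w (x + h *: unitv R j) - smooth_in l w (x - h *: unitv R j)) / (2 * h)).
    move=> x; apply: (@cont_mul R 'cV[R]_N (fun x => smooth_in l w (x + h *: unitv R j) - smooth_in l w (x - h *: unitv R j)) (fun=> (2 * h)^-1)).
      by apply: (@cont_sub R 'cV[R]_N (fun x => smooth_in l w (x + h *: unitv R j)) (fun x => smooth_in l w (x - h *: unitv R j))); exact: cont_shift.
    exact: cont_cst.
  by move=> x; exact: steklov_derive.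
exists (steklov h j g'); first exact: steklov_continuous.
by apply: steklov_derive_inside.
Qed.

Definition smooth w := smooth_in (enum 'I_N) w.

Lemma smooth_continuous w : continuous w -> continuous (smooth w).
Proof. exact: smooth_in_continuous. Qed.

Lemma smooth_C1g w : continuous w -> C1g (smooth w).
Proof.
move=> cw; split=> [|i]; first exact: smooth_continuous.
by apply: smooth_in_C1 => //; rewrite mem_enum.
Qed.

Lemma smooth_C2g w : C1g w -> C2g (smooth w).
Proof.
move=> [cw dw]; split=> [|i]; first exact: smooth_continuous.
have [w' cw' Hw] := dw i; exists (smooth w'); first exact: smooth_C1g.
exact: smooth_in_derive.
Qed.

Lemma steklov_le i w x c : continuous w -> (forall z, `|z - x| <= h -> w z <= c) ->
  steklov h i w x <= c.
Proof.
move=> cw wc; have [s sh ->] := steklov_value h0 i x cw.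
have hs t : `|t| <= h -> `|x + t *: unitv R i - x| <= h.
  by move=> th; rewrite addrC addKr normrZ; apply: le_trans th; rewrite ler_piMr// normr_unitv.
have h1 := wc _ (hs _ sh); have h2 : w (x - s *: unitv R i) <= c.
  by rewrite -scaleNr; apply/wc/hs; rewrite normrN.
by move: h1 h2; lra.
Qed.

Lemma steklov_sdiff i w x d : continuous w ->
  sdiff (steklov h i w) x d = steklov h i (fun z => sdiff w z d) x.
Proof.
move=> cw; rewrite (_ : (fun z => sdiff w z d) =
    fun z => (-2) * w z + (1 * w (z + d) + w (z + - d))); last first.
  by apply/funext => z; rewrite /sdiff; ring.
rewrite steklov_lin//; last by apply: continuous_lin; exact: cont_shift.
rewrite steklov_lin//; try exact: cont_shift.
by rewrite !steklov_shift /sdiff; ring.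
Qed.

Lemma sdiff_continuous w d : continuous w -> continuous (fun z => sdiff w z d).
Proof.
move=> cw; rewrite (_ : (fun z => sdiff w z d) =
    fun z => (-2) * w z + (1 * w (z + d) + w (z + - d))); last first.
  by apply/funext => z; rewrite /sdiff; ring.
by apply: continuous_lin => //; apply: continuous_lin; exact: cont_shift.
Qed.

Lemma steklov_opp i w x : continuous w -> steklov h i (fun z => - w z) x = - steklov h i w x.
Proof.
move=> cw; have := @steklov_lin _ _ _ h0 i w w (-2) x cw cw.
rewrite (_ : (fun z => _) = fun z => - w z) => [->|]; first by ring.
by apply/funext => z; ring.
Qed.

Lemma smooth_in_le l w x c : continuous w ->
  (forall z, `|z - x| <= (size l)%:R * h -> w z <= c) -> smooth_in l w x <= c.
Proof.
move=> cw; elim: l x => [|i l IH] x wc /=.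
  by apply: wc; rewrite subrr normr0 mul0r.
apply: steklov_le => [|z zx]; first exact: smooth_in_continuous.
apply: IH => y yz; apply: wc; rewrite -[y](subrK z) -addrA (le_trans (ler_normD _ _))//.
by rewrite -[size _]addn1 natrD mulrDl mul1r lerD.
Qed.

Lemma smooth_in_sdiff l w x d : continuous w ->
  sdiff (smooth_in l w) x d = smooth_in l (fun z => sdiff w z d) x.
Proof.
move=> cw; elim: l x => //= i l IH x.
rewrite steklov_sdiff; last exact: smooth_in_continuous.
by congr steklov; apply/funext => z; rewrite IH.
Qed.

Lemma smooth_in_opp l w x : continuous w ->
  smooth_in l (fun z => - w z) x = - smooth_in l w x.
Proof.
move=> cw; elim: l x => //= i l IH x.
rewrite -steklov_opp; last exact: smooth_in_continuous.
by congr steklov; apply/funext => z; rewrite IH.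
Qed.

End Smoothing.

Lemma smoothing w rho : continuous w -> 0 < rho -> exists W,
  [/\ C2g W,
      (forall x c, (forall z, `|z - x| <= rho -> w z <= c) -> W x <= c),
      (forall x c, (forall z, `|z - x| <= rho -> c <= w z) -> c <= W x) &
      (forall x d c, (forall z, `|z - x| <= rho -> sdiff w z d <= c) -> sdiff W x d <= c)].
Proof.
move=> cw rho0; pose l := enum 'I_N ++ enum 'I_N.
pose h := rho / ((size l)%:R + 1).
have l0 : 0 < (size l)%:R + 1 :> R by rewrite ltr_wpDl.
have h0 : 0 < h by rewrite divr_gt0.
have lh z x : `|z - x| <= (size l)%:R * h -> `|z - x| <= rho.
  move=> H; apply: le_trans H _; rewrite /h mulrCA ger_pMr// ler_pdivrMr// mul1r.
  by rewrite lerDl.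
exists (smooth_in h l w).
have cl := @smooth_in_continuous h h0 l w cw.
split.
- rewrite /l /smooth_in foldr_cat; apply: smooth_C2g => //; exact: smooth_C1g.
- by move=> x c H; apply: smooth_in_le => // z /lh; exact: H.
- move=> x c H; rewrite -lerN2 -smooth_in_opp//; apply: smooth_in_le => //.
    by move=> z; exact: (@cvgN _ _ _ _ _ w _ (cw z)).
  by move=> z /lh zx; rewrite lerN2; exact: H.
- move=> x d c H; rewrite smooth_in_sdiff//; apply: smooth_in_le => //.
    exact: sdiff_continuous.
  by move=> z /lh; exact: H.
Qed.

End GlobalC2.
Section ViscosityToSupersolution.
Variables (R : realType) (N : nat).
Hypothesis N0 : (0 < N)%N.
Implicit Types (x y z d : 'cV[R]_N) (A : set 'cV[R]_N) (f u v w psi : 'cV[R]_N -> R).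

Lemma nsq_perp y d : d != 0 ->
  nsq (y - (dot y d / nsq d) *: d) = nsq y - dot y d ^+ 2 / nsq d.
Proof.
move=> d0; have n0 : nsq d != 0 by rewrite gt_eqF// nsq_gt0.
rewrite [LHS]nsqE !dotE -!nsqE (dotC d y); field.
exact: n0.
Qed.

(* Otherwise test [v] from below with [q - K p], where [q] is a parabola of second
   derivative [m' > m] along [d] agreeing with [v] at [x +- d] and [p] is the squared
   distance to the line: [v < q] at [x], so for large [K] the minimum of
   [v - q + K p] over a thin tube around the segment is interior. *)
Lemma viscosity_sdiff A f v x d m r0 : open A -> C0_on A v ->
  (forall psi z, C2_on A psi -> A z -> is_local_min (fun y => v y - psi y) z ->
     P1plus (hessian psi z) <= f z) ->
  (forall z, `|z - x| < r0 -> A z /\ f z <= m) -> enorm d < r0 ->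
  sdiff v x d <= m * nsq d.
Proof.
move=> oA cv vsup H dr0.
have [->|d0] := eqVneq d 0.
  by rewrite /sdiff -(scale0r 0) nsqZ expr0n/= scale0r subr0 addr0; lra.
rewrite leNgt; apply/negP => lt.
have D0 := nsq_gt0 d0; set D := nsq d in D0 lt *.
pose m' := (m + sdiff v x d / D) / 2.
have mm' : m < m' /\ m' * D < sdiff v x d.
  have h : m < sdiff v x d / D by rewrite ltr_pdivlMr.
  split; first by rewrite /m'; lra.
  by rewrite -ltr_pdivlMr// /m'; lra.
case: mm' => mm' m'd.
pose Q0 := (v (x + d) + v (x - d)) / 2 - m' * D / 2.
pose B := (v (x + d) - v (x - d)) / 2.
pose sg := Q0 - v x.
have sg0 : 0 < sg by rewrite /sg /Q0; move: m'd; rewrite /sdiff; lra.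
pose tau z := dot (z - x) d.
pose p z := nsq (z - x) - tau z ^+ 2 / D.
pose q z := Q0 + B / D * tau z + m' / (2 * D) * tau z ^+ 2.
have pE z : p z = nsq (z - x - (tau z / D) *: d) by rewrite nsq_perp.
have p0 z : 0 <= p z by rewrite pE; exact: nsq_ge0.
have r00 : 0 < r0 by apply: le_lt_trans dr0; exact: enorm_ge0.
have Dr0 : D < r0 ^+ 2.
  by rewrite /D -sqr_enorm ltr_sqr ?nnegrE ?enorm_ge0// ltW.
have xd s : `|s| <= 1 -> A (x + s *: d).
  move=> s1; apply: (H _ _).1; rewrite addrC addKr normrZ; apply: le_lt_trans dr0.
  by apply: le_trans (norm_le_enorm d); rewrite ler_piMl.
have sg2 : 0 < sg / 2 by rewrite divr_gt0.
have [|r1 r10 H1] := (cont_epsP v (x + d)).1 _ _ sg2.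
  by apply: cv; rewrite -[d]scale1r; apply: xd; rewrite normr1.
have [|r2 r20 H2] := (cont_epsP v (x - d)).1 _ _ sg2.
  by apply: cv; rewrite -scaleN1r; apply: xd; rewrite normrN normr1.
pose rho := Num.min (Num.min r1 r2 / 2) (Num.sqrt ((r0 ^+ 2 - D) / 2)).
have rho0 : 0 < rho.
  by rewrite !lt_min divr_gt0 ?lt_min ?r10//= sqrtr_gt0 divr_gt0// subr_gt0.
have rhor1 : rho < r1 /\ rho < r2.
  have h : rho <= Num.min r1 r2 / 2 by rewrite /rho ge_min lexx.
  have h' : 0 < Num.min r1 r2 by rewrite lt_min r10.
  have h1 : Num.min r1 r2 <= r1 by rewrite ge_min lexx.
  have h2 : Num.min r1 r2 <= r2 by rewrite ge_min lexx orbT.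
  by split; lra.
have rhor0 : D + rho ^+ 2 < r0 ^+ 2.
  have h : rho ^+ 2 <= (r0 ^+ 2 - D) / 2.
    have h0 : 0 <= (r0 ^+ 2 - D) / 2 by rewrite divr_ge0// subr_ge0 ltW.
    rewrite -[leRHS](sqr_sqrtr h0) ler_sqr ?nnegrE ?sqrtr_ge0// ?(ltW rho0)//.
    by rewrite /rho ge_min lexx orbT.
  by lra.
clearbody rho; case: rhor1 => rhor1 rhor2.
pose T := [set z | p z <= rho ^+ 2] `&` [set z | tau z ^+ 2 <= D ^+ 2].
have Tr z : T z -> `|z - x| < r0.
  move=> [/= pz tz]; apply: le_lt_trans (norm_le_enorm _) _.
  rewrite -(@ltr_pXn2r _ 2)// ?nnegrE ?enorm_ge0// ?(ltW r00)// sqr_enorm.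
  have -> : nsq (z - x) = p z + tau z ^+ 2 / D by rewrite /p; ring.
  have : tau z ^+ 2 / D <= D by rewrite ler_pdivrMr// -expr2.
  by lra.
have C2tau : C2g tau by exact: C2g_dot.
have C2tau2 : C2g (fun z => tau z ^+ 2).
  by rewrite (_ : (fun z => _) = fun z => tau z * tau z); [exact: C2g_mul|apply/funext => z; rewrite expr2].
have C2p : C2g p.
  rewrite (_ : p = fun z => nsq (z - x) + - D^-1 * tau z ^+ 2); last first.
    by apply/funext => z; rewrite /p; ring.
  by apply: C2g_add; [exact: C2g_nsq|apply: C2g_mul => //; exact: C2g_cst].
have C2q : C2g q.
  apply: C2g_add; last by apply: C2g_mul => //; exact: C2g_cst.
  by apply: C2g_add; [exact: C2g_cst|apply: C2g_mul => //; exact: C2g_cst].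
have cT : compact T.
  apply: compact_cV.
    exists (`|x| + r0); split; first exact: num_real.
    move=> M' hM z /Tr zr; apply: ltW; apply: lt_trans hM.
    by rewrite -[z](subrK x) (le_lt_trans (ler_normD _ _))// addrC ltrD2l.
  apply: closedI.
    rewrite (_ : [set z | _] = p @^-1` [set t : R | t <= rho ^+ 2])//.
    by apply: preimage_closed => [z _|]; [exact: C2p.1|exact: closed_le].
  rewrite (_ : [set z | _] = (fun z => tau z ^+ 2) @^-1` [set t : R | t <= D ^+ 2])//.
  by apply: preimage_closed => [z _|]; [exact: C2tau2.1|exact: closed_le].
have taux : tau x = 0 by rewrite /tau subrr -(scale0r 0) dotZl mul0r.
have px : p x = 0.
  by rewrite /p taux subrr -(scale0r 0) nsqZ expr0n/=; ring.
have Tx : T x by split; rewrite /= ?px ?taux ?expr0n/= sqr_ge0.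
have T0 : T !=set0 by exists x.
have cvT z : T z -> {for z, continuous v} by move=> /Tr/H[Az _]; exact: cv.
have [b _ minb] : exists2 b, b \in T & forall z, z \in T -> v b <= v z.
  apply: compact_EVT_min T0 cT _.
  by apply: continuous_in_subspaceT => z /set_mem; exact: cvT.
pose K := (`|v b| + (`|Q0| + `|B| + `|m'| * D / 2)) / rho ^+ 2.
have K0 : 0 <= K.
  by rewrite divr_ge0 ?sqr_ge0// !addr_ge0// divr_ge0// mulr_ge0// ltW.
pose psi z := q z + - K * p z.
have C2psi : C2g psi by apply: C2g_add => //; apply: C2g_mul => //; exact: C2g_cst.
have [c /set_mem Tc minc] : exists2 c, c \in T & forall z, z \in T -> v c - psi c <= v z - psi z.
  apply: (@compact_EVT_min _ _ (fun z => v z - psi z)) T0 cT _.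
  apply: continuous_in_subspaceT => z /set_mem Tz.
  by apply: cont_sub; [exact: cvT|exact: C2psi.1].
have gc : v c - psi c <= - sg.
  have := minc x; rewrite inE => /(_ Tx).
  have -> : psi x = Q0 by rewrite /psi /q taux px; ring.
  have -> : v x - Q0 = - sg by rewrite /sg; ring.
  by [].
have near_end z s (s1 : s = 1 \/ s = -1) : T z -> tau z = s * D -> `|z - (x + s *: d)| <= rho.
  move=> [/= pz _] tz; apply: le_trans (norm_le_enorm _) _.
  rewrite -(@ler_pXn2r _ 2)// ?nnegrE ?enorm_ge0// ?(ltW rho0)// sqr_enorm.
  apply: le_trans pz; rewrite pE tz mulfK ?gt_eqF//.
  by rewrite opprD addrA.
have qend s : s = 1 \/ s = -1 -> forall z, tau z = s * D -> q z = v (x + s *: d).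
  move=> s1 z tz; rewrite /q tz.
  have -> : Q0 + B / D * (s * D) + m' / (2 * D) * (s * D) ^+ 2 = Q0 + s * B + s ^+ 2 * m' * D / 2.
    by field; rewrite gt_eqF.
  rewrite /Q0 /B; case: s1 => ->; first by rewrite scale1r; field.
  by rewrite scaleN1r; field.
have not_end s : s = 1 \/ s = -1 -> tau c <> s * D.
  move=> s1 tc; have h1 := near_end c s s1 Tc tc; have h2 := qend s s1 c tc.
  have : `|v c - v (x + s *: d)| < sg / 2.
    case: s1 => sE; move: h1; rewrite sE ?scale1r ?scaleN1r => h1.
      by apply: H1; exact: le_lt_trans h1 rhor1.
    by apply: H2; exact: le_lt_trans h1 rhor2.
  move=> /ltr_normlP[h3 _]; move: gc; rewrite /psi h2.
  by have := mulr_ge0 K0 (p0 c); lra.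
have tc2 : tau c ^+ 2 < D ^+ 2.
  rewrite lt_neqAle Tc.2 andbT; apply/negP; rewrite eqf_sqr => /orP[/eqP|/eqP] h.
    by apply: (not_end 1); [left|rewrite mul1r].
  by apply: (not_end (-1)); [right|rewrite mulN1r].
have tc1 : `|tau c| <= D.
  by rewrite -(@ler_pXn2r _ 2)// ?nnegrE ?(ltW D0)// real_normK ?num_real// ltW.
have pc : p c < rho ^+ 2.
  rewrite lt_neqAle Tc.1 andbT; apply/negP => /eqP pc.
  have Kp : K * p c = `|v b| + (`|Q0| + `|B| + `|m'| * D / 2).
    by rewrite pc /K mulfVK// gt_eqF// exprn_gt0.
  have q1 : q c <= `|Q0| + `|B| + `|m'| * D / 2.
    rewrite /q; apply: lerD; first apply: lerD.
    - exact: ler_norm.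
    - apply: le_trans (ler_norm _) _; rewrite normrM normrM normfV (gtr0_norm D0).
      by rewrite -mulrA ler_piMr// mulrC ler_pdivrMr// mul1r.
    - have -> : m' / (2 * D) * tau c ^+ 2 = m' * (tau c ^+ 2 / (2 * D)) by ring.
      have D2 : 0 < 2 * D by rewrite mulr_gt0.
      have t0 : 0 <= tau c ^+ 2 / (2 * D) by rewrite divr_ge0 ?sqr_ge0// ltW.
      apply: le_trans (ler_wpM2r t0 (ler_norm m')) _.
      rewrite -[leRHS]mulrA ler_wpM2l// ler_pdivrMr//.
      have -> : D / 2 * (2 * D) = D ^+ 2 by field.
      exact: ltW.
  have vb : v b <= v c by apply: minb; rewrite inE.
  have nb := ler_norm (- v b); rewrite normrN in nb.
  by move: gc; rewrite /psi mulNr Kp; lra.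
have lmin : is_local_min (fun z => v z - psi z) c.
  apply/norm_near.
  have h1 : 0 < rho ^+ 2 - p c by rewrite subr_gt0.
  have h2 : 0 < D ^+ 2 - tau c ^+ 2 by rewrite subr_gt0.
  have [s1 s10 S1] := (cont_epsP p c).1 (C2p.1 c) _ h1.
  have [s2 s20 S2] := (cont_epsP (fun z => tau z ^+ 2) c).1 (C2tau2.1 c) _ h2.
  exists (Num.min s1 s2) => [|z]; first by rewrite lt_min s10.
  rewrite lt_min => /andP[/S1/ltr_normlP[_ z1] /S2/ltr_normlP[_ z2]].
  rewrite ltrD2r in z1; rewrite ltrD2r in z2.
  by apply: minc; rewrite inE; split=> /=; exact: ltW.
have [Ac fc] := H c (Tr c Tc).
have Pf : P1plus (hessian psi c) <= m.
  exact: (le_trans (vsup psi c (C2g_C2_on A C2psi) Ac lmin) fc).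
have e0 : 0 < (m' - m) / 2 by rewrite divr_gt0// subr_gt0.
have [r3 r30 H3] := sdiff_le_P1plus N0 oA (C2g_C2_on A C2psi) Ac e0.
have nd : 0 < `|d| by rewrite normr_gt0.
pose k := r3 / `|d| / 2.
have k0 : 0 < k by rewrite !divr_gt0.
have := H3 c (k *: d); rewrite subrr normr0 r30 normrZ (gtr0_norm k0) => /(_ isT).
have -> : k * `|d| < r3.
  have -> : k * `|d| = r3 / 2 by rewrite /k; field; rewrite gt_eqF.
  by rewrite ltr_pdivrMr// ltr_pMr// ltr1n.
move=> /(_ isT).
have tk s : tau (c + s *: d) = tau c + s * D.
  have -> : tau (c + s *: d) = dot ((c - x) + s *: d) d by rewrite /tau [c + _ - x]addrAC.
  by rewrite dotDl dotZl -nsqE.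
have nk s : nsq (c + s *: d - x) = nsq (c - x) + 2 * s * tau c + s ^+ 2 * D.
  have -> : c + s *: d - x = (c - x) + s *: d by rewrite addrAC.
  rewrite /tau; move: (c - x) => y.
  by rewrite nsqE !dotE -!nsqE -/D (dotC d y); ring.
rewrite /sdiff -scaleNr /psi /q /p !tk !nk nsqZ -/D => h.
have : m' * (k ^+ 2 * D) <= (P1plus (hessian psi c) + (m' - m) / 2) * (k ^+ 2 * D).
  apply: le_trans h; rewrite le_eqVlt; apply/orP; left; apply/eqP; field.
  by rewrite gt_eqF.
rewrite ler_pM2r; last by rewrite mulr_gt0// exprn_gt0.
by move: mm' Pf; lra.
Qed.

End ViscosityToSupersolution.
Section Comparison.
Variables (R : realType) (N : nat).
Hypothesis N0 : (0 < N)%N.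
Implicit Types (x y z d : 'cV[R]_N) (A : set 'cV[R]_N) (f u v w psi : 'cV[R]_N -> R).

Definition zero_ext A v x : R := if `[< A x >] then v x else 0.

Lemma zero_ext_in A v x : A x -> zero_ext A v x = v x.
Proof. by move=> Ax; rewrite /zero_ext asboolT. Qed.

Lemma zero_ext_out A v x : ~ A x -> zero_ext A v x = 0.
Proof. by move=> Ax; rewrite /zero_ext asboolF. Qed.

Lemma zero_ext_continuous_in A v x : open A -> {for x, continuous v} -> A x ->
  {for x, continuous (zero_ext A v)}.
Proof.
move=> oA cv Ax; have [r r0 H] := open_norm oA Ax.
by apply: (cont_eq_near r0 _ cv) => z /H /zero_ext_in.
Qed.

Lemma zero_ext_continuous A v : open A -> {within closure A, continuous v} ->
  (forall x, boundary A x -> v x = 0) -> continuous (zero_ext A v).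
Proof.
move=> oA /subspace_continuousP cv bv x.
have [Ax|nAx] := pselect (A x).
  have [r r0 H] := open_norm oA Ax.
  apply: zero_ext_continuous_in => //; apply/cont_epsP => e e0.
  have /cvgrPdist_lt /(_ e e0) := cv x (subset_closure Ax).
  rewrite near_withinE => /norm_near[s s0 S].
  exists (Num.min r s) => [|z]; first by rewrite lt_min r0.
  rewrite lt_min => /andP[/H Az zs]; rewrite distrC; apply: S => //.
  exact: subset_closure.
apply/cont_epsP => e e0; rewrite (zero_ext_out _ nAx).
have [cx|ncx] := pselect (closure A x).
  have vx : v x = 0.
    by apply: bv; split=> //; rewrite (interior_id A).1.
  have /cvgrPdist_lt /(_ e e0) := cv x cx.
  rewrite near_withinE => /norm_near[s s0 S].
  exists s => // z zs; have [Az|nAz] := pselect (A z).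
    have h : `|v x - v z| < e := S z zs (subset_closure Az).
    by rewrite vx sub0r normrN in h; rewrite zero_ext_in// subr0.
  by rewrite zero_ext_out// subrr normr0.
have oC : open (~` closure A) by apply: closed_openC; exact: closed_closure.
have [s s0 S] := open_norm oC ncx.
exists s => // z /S nz; rewrite zero_ext_out ?subrr ?normr0// => Az.
by apply: nz; exact: subset_closure.
Qed.

Lemma zero_ext_supersol A f v : open A -> C0_on A f ->
  {within closure A, continuous v} -> (forall x, boundary A x -> v x = 0) ->
  C0_on A v ->
  (forall psi z, C2_on A psi -> A z -> is_local_min (fun y => v y - psi y) z ->
     P1plus (hessian psi z) <= f z) ->
  zero_supersol A f (zero_ext A v).
Proof.
move=> oA cf cv bv c0v vsup.
have cz := zero_ext_continuous oA cv bv.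
split; last by move=> x; exact: zero_ext_out.
apply: supersol_pointwise => [x _|x _|x Ax e e0].
- exact: cz.
- exact/cont_lsc/cz.
have [r1 r10 H1] := open_norm oA Ax.
have /cont_epsP /(_ e e0)[r2 r20 H2] := cf x Ax.
pose r := Num.min r1 r2; have r0 : 0 < r by rewrite lt_min r10.
have Np : 0 < N%:R :> R by rewrite ltr0n.
have H z : `|z - x| < r -> A z /\ f z <= f x + e.
  rewrite lt_min => /andP[z1 /H2/ltW z2]; split; first exact: H1.
  by move: z2; rewrite ler_distl => /andP[].
exists (r / N%:R) => [|d dr]; first by rewrite divr_gt0.
have dr0 : enorm d < r.
  by apply: le_lt_trans (enorm_le_norm _) _; rewrite mulrC -ltr_pdivlMr.
have := viscosity_sdiff N0 oA c0v vsup H dr0; rewrite /sdiff.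
have dr1 : `|d| < r := le_lt_trans (norm_le_enorm d) dr0.
have Ap : A (x + d) by apply: (H _ _).1; rewrite addrC addKr.
have Am : A (x - d) by apply: (H _ _).1; rewrite addrC addKr normrN.
by rewrite !zero_ext_in.
Qed.

(* The maximum point [x0] of [v - u + e |x|^2] is made strict by subtracting
   [(e / 2) |x - x0|^2]; it then survives replacing [u] by a smooth average [W]. *)
Lemma comparison A f u v : open A -> bounded_set A -> C0_on A f ->
  zero_supersol A f u -> continuous u ->
  {within closure A, continuous v} -> (forall x, boundary A x -> v x = 0) ->
  (forall psi z, C2_on A psi -> A z -> is_local_max (fun y => v y - psi y) z ->
     f z <= P1plus (hessian psi z)) ->
  forall x, A x -> v x <= u x.
Proof.
move=> oA bA cf [us u0] cu cv bv vsub x1 Ax1; rewrite leNgt; apply/negP => lt1.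
have cz := zero_ext_continuous oA cv bv; set v' := zero_ext A v in cz.
have cC : compact (closure A).
  exact: compact_closure.
have cn : continuous (fun z : 'cV[R]_N => nsq z) by exact: nsq_continuous.
have [xm _ maxn] : exists2 b, b \in closure A & forall z, z \in closure A -> nsq z <= nsq b.
  apply: (@compact_EVT_max _ _ (@nsq R N)) _ cC _; first by exists x1; exact: subset_closure.
  exact: continuous_subspaceT.
pose S := nsq xm + 1; have S0 : 0 < S by rewrite ltr_wpDl// nsq_ge0.
pose m := v x1 - u x1; have m0 : 0 < m by rewrite subr_gt0.
pose e := m / S / 2; have e0 : 0 < e by rewrite !divr_gt0.
pose Phi z := v' z - u z + e * nsq z.
have cPhi : continuous Phi.
  move=> z; have h1 : {for z, continuous (fun z => v' z - u z)} := cont_sub (cz z) (cu z).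
  have h2 : {for z, continuous (fun z : 'cV[R]_N => e * nsq z)}.
    rewrite (_ : (fun y : 'cV[R]_N => _) = fun y => e * nsq (y - 0)).
      exact: ((C2g_mul (C2g_cst N e) (C2g_nsq 0)).1 z).
    by apply/funext => y; rewrite subr0.
  exact: cont_add h1 h2.
have [x0 /set_mem Cx0 maxPhi] : exists2 b, b \in closure A & forall z, z \in closure A -> Phi z <= Phi b.
  apply: (@compact_EVT_max _ _ Phi) _ cC _; first by exists x1; exact: subset_closure.
  exact: continuous_subspaceT.
have Ax0 : A x0.
  apply: contrapT => nA; have := maxPhi x1; rewrite inE => /(_ (subset_closure Ax1)).
  rewrite /Phi /v' (zero_ext_in _ Ax1) (zero_ext_out _ nA) (u0 _ nA) -/m.
  have : e * nsq x0 <= e * S.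
    rewrite ler_wpM2l ?(ltW e0)// /S; have := maxn x0; rewrite inE => /(_ Cx0); lra.
  have : e * S = m / 2 by rewrite /e; field; rewrite gt_eqF.
  have := mulr_ge0 (ltW e0) (nsq_ge0 x1).
  by move: m0; lra.
have [r1 r10 H1] := open_norm oA Ax0.
have e4 : 0 < e / 4 by rewrite divr_gt0.
have /cont_epsP /(_ _ e4)[r2 r20 H2] := cf x0 Ax0.
pose r := Num.min r1 r2 / 4.
have m12 : 0 < Num.min r1 r2 by rewrite lt_min r10.
have r0 : 0 < r by rewrite divr_gt0.
have Hr z : `|z - x0| < 4 * r -> A z /\ f x0 - e / 4 <= f z <= f x0 + e / 4.
  have -> : 4 * r = Num.min r1 r2 by rewrite /r; field.
  by rewrite lt_min -ler_distl => /andP[/H1 ? /H2/ltW ?].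
pose eta := e * r ^+ 2 / 8.
have er0 : 0 < e * r ^+ 2 by rewrite mulr_gt0// exprn_gt0.
have eta0 : 0 < eta by rewrite divr_gt0.
have [s s0 Hs] := compact_unif_cont cu (@compact_closed_ball R N x0 r) eta0.
pose rho := Num.min r s / 2.
have rho0 : 0 < rho by rewrite divr_gt0// lt_min r0.
have rhors : rho < r /\ rho < s.
  have hm : 0 < Num.min r s by rewrite lt_min r0.
  have h1 : Num.min r s <= r by rewrite ge_min lexx.
  have h2 : Num.min r s <= s by rewrite ge_min lexx orbT.
  by split; apply: lt_le_trans h1 || apply: lt_le_trans h2; rewrite /rho ltr_pdivrMr// ltr_pMr// ltr1n.
case: rhors => rhor rhos.
have [W [W2 Wle Wge Wsd]] := smoothing cu rho0.
have Wu z : `|z - x0| <= r -> `|W z - u z| <= eta.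
  move=> zr; rewrite ler_distl; apply/andP; split; [apply: Wge|apply: Wle] => y yz;
    have := Hs z y zr (le_lt_trans yz rhos) => /ltW; rewrite ler_distl => /andP[] //.
pose psi z := W z + (- e * nsq (z - 0) + e / 2 * nsq (z - x0)).
have C2psi : C2g psi.
  apply: C2g_add W2 _; apply: C2g_add; apply: C2g_mul; try exact: C2g_cst; exact: C2g_nsq.
pose K := [set z : 'cV[R]_N | `|z - x0| <= r].
have Kx0 : K x0 by rewrite /K/= subrr normr0 ltW.
have [c /set_mem Kc maxc] : exists2 b, b \in K & forall z, z \in K -> v' z - psi z <= v' b - psi b.
  apply: (@compact_EVT_max _ _ (fun z => v' z - psi z)) _ (@compact_closed_ball R N x0 r) _.
    by exists x0.
  by apply: continuous_subspaceT => z; exact: cont_sub (cz z) (C2psi.1 z).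
have KA z : K z -> `|z - x0| < 4 * r by move=> zr; apply: le_lt_trans zr _; rewrite ltr_pMl// ltr1n.
have psiE z : v' z - psi z = Phi z + (u z - W z) - e / 2 * nsq (z - x0).
  by rewrite /psi /Phi subr0; ring.
have cr : `|c - x0| < r.
  rewrite lt_neqAle Kc andbT; apply/negP => /eqP ccr.
  have := maxc x0; rewrite inE => /(_ Kx0); rewrite !psiE subrr.
  have -> : nsq (0 : 'cV[R]_N) = 0 by rewrite -(scale0r 0) nsqZ expr0n mul0r.
  have := maxPhi c; rewrite inE => /(_ (subset_closure (Hr c (KA c Kc)).1)).
  have := Wu c Kc; rewrite ler_distl => /andP[h1 h2].
  have := Wu x0 Kx0; rewrite ler_distl => /andP[h3 h4].
  have : e * r ^+ 2 <= e * nsq (c - x0).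
    rewrite ler_wpM2l ?(ltW e0)// -sqr_enorm -ccr ler_sqr ?nnegrE ?enorm_ge0//.
    exact: norm_le_enorm.
  move: h1 h2 h3 h4 er0; rewrite /eta; lra.
have Ac := (Hr c (KA c Kc)).1.
have lmax : is_local_max (fun z => v z - psi z) c.
  apply/norm_near; exists (r - `|c - x0|) => [|z zc]; first by rewrite subr_gt0.
  have Kz : K z.
    rewrite /K/= -[z](subrK c) -addrA (le_trans (ler_normD _ _))//.
    by rewrite -lerBrDr ltW.
  have := maxc z; rewrite inE => /(_ Kz).
  by rewrite /v' !zero_ext_in//; exact: (Hr z (KA z Kz)).1.
have := vsub psi c (C2g_C2_on A C2psi) Ac lmax.
have := (Hr c (KA c Kc)).2 => /andP[fc _].
suff : P1plus (hessian psi c) <= f x0 + e / 4 - e by lra.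
apply: (P1plus_hessian_le N0 oA (C2g_C2_on A C2psi) Ac) => e1 e10.
exists r => // d dr.
have sW : sdiff W c d <= (f x0 + e / 4) * nsq d.
  apply: Wsd => z zc; apply: supersol_sdiff us _ => t t1.
  have /Hr[h /andP[_ h']] : `|z + t *: d - x0| < 4 * r.
    have -> : z + t *: d - x0 = (z - c) + (c - x0) + t *: d by rewrite addrA subrK addrAC.
    have td : `|t *: d| < r.
      by apply: le_lt_trans dr; rewrite normrZ ler_piMl// ltW.
    rewrite (le_lt_trans (ler_normD _ _))//.
    have := ler_normD (z - c) (c - x0).
    by lra.
  by split.
have -> : sdiff psi c d = sdiff W c d + (- e * (2 * nsq d) + e / 2 * (2 * nsq d)).
  by rewrite -{1}(sdiff_nsq 0 c d) -(sdiff_nsq x0 c d) /psi /sdiff; ring.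
by have := mulr_ge0 (ltW e10) (nsq_ge0 d); lra.
Qed.

End Comparison.
Section CosineSupersolution.
Variables (R : realType) (N : nat).
Implicit Types (x y z d : 'cV[R]_N) (A : set 'cV[R]_N) (f : 'cV[R]_N -> R).

Lemma rot_coord_line (c : 'cV[R]_N * 'M[R]_N) x d t i :
  rot_coord c (x + t *: d) i ord0 = rot_coord c x i ord0 + t * (c.2^T *m d) i ord0.
Proof.
have -> : rot_coord c (x + t *: d) = rot_coord c x + t *: (c.2^T *m d).
  by rewrite /rot_coord mulmxDr -scalemxAr addrAC.
by rewrite [in LHS]mxE [X in _ + X]mxE.
Qed.

Lemma cos_supersol A f c (alpha beta : R) : (0 < N)%N -> open A -> C0_on A f ->
  orthogonal_matrices c.2 -> A `<=` rot_cube c -> 0 < alpha -> 0 < beta <= 1 ->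
  (forall x, A x -> - alpha * rot_phi c x `^ beta <= f x) ->
  zero_supersol A f (zero_ext A (fun x => alpha * N%:R / beta * rot_phi c x `^ beta)).
Proof.
move=> N0 oA cf cO Ac a0 /andP[b0 b1] hf.
pose k := alpha * N%:R / beta; pose s := beta / N%:R.
have Np : 0 < N%:R :> R by rewrite ltr0n.
have k0 : 0 <= k by rewrite divr_ge0 ?(ltW b0)// mulr_ge0// ltW.
have s0 : 0 < s by rewrite divr_gt0.
have ks : k * s = alpha by rewrite /k /s; field; rewrite !gt_eqF.
have sN : s * N%:R <= 1 by rewrite /s mulfVK// gt_eqF.
split; last by move=> x; exact: zero_ext_out.
apply: supersol_pointwise.
- move=> x Ax; apply: zero_ext_continuous_in => //.
  have [r r0 H] := open_norm oA Ax.
  apply: (@cont_eq_near _ _ _ (fun z => k * expR (s * \sum_i ln (cos (rot_coord c z i ord0)))) x r r0).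
    by move=> z /H /Ac cz; rewrite rot_phi_pow.
  apply: cont_mul; first exact: cont_cst.
  apply: (@continuous_comp _ _ _ (fun z => s * \sum_i ln (cos (rot_coord c z i ord0))) expR);
    last exact: continuous_expR.
  apply: cont_mul; first exact: cont_cst.
  apply: cont_sum => i.
  have ci : 0 < cos (rot_coord c x i ord0).
    by have /(rot_cube_coord cO)/(_ i) := Ac _ Ax; exact: cos_gt0_pihalf.
  apply: (@continuous_comp _ _ _ (fun z => cos (rot_coord c z i ord0)) (@ln R));
    last exact: continuous_ln.
  apply: (@continuous_comp _ _ _ (fun z => rot_coord c z i ord0) (@cos R));
    last exact: continuous_cos.
  rewrite (_ : (fun z => _) = fun z => (c.2^T *m z) i ord0 - c.1 i ord0); last first.
    by apply/funext => z; rewrite coordB.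
  apply: cont_sub; last exact: cont_cst.
  by apply: (@cont_coord _ _ (fun z => c.2^T *m z)); exact: mulmx_continuous.
- move=> x nAx e e0; exists 1 => // z _; rewrite zero_ext_out// sub0r.
  have [Az|nAz] := pselect (A z); last by rewrite zero_ext_out// oppr_le0 ltW.
  rewrite zero_ext_in//; apply: (@le_trans _ _ 0); first by rewrite oppr_le0 ltW.
  by rewrite mulr_ge0// powR_ge0.
- move=> x Ax e e0.
  have [r1 r10 H1] := open_norm oA Ax.
  have /cont_epsP /(_ e e0)[r2 r20 H2] := cf x Ax.
  exists (Num.min r1 r2) => [|d]; first by rewrite lt_min r10.
  rewrite lt_min => /andP[d1 d2].
  have hd t r : `|t| <= 1 -> `|d| < r -> `|x + t *: d - x| < r.
    move=> t1; apply: le_lt_trans.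
    by rewrite addrC addKr normrZ ler_piMl.
  have Ad t : `|t| <= 1 -> A (x + t *: d) by move=> t1; apply: H1; exact: hd.
  pose xi i := rot_coord c x i ord0; pose eta i := (c.2^T *m d) i ord0.
  have vE t : `|t| <= 1 -> k * rot_phi c (x + t *: d) `^ beta =
      k * expR (s * \sum_i ln (cos (xi i + t * eta i))).
    move=> /Ad/Ac cx; rewrite rot_phi_pow//; congr (_ * expR (_ * _)).
    by apply: eq_bigr => i _; rewrite rot_coord_line.
  have n0 : `|0 : R| <= 1 by rewrite normr0.
  have n1 : `|1 : R| <= 1 by rewrite normr1.
  have nN1 : `|-1 : R| <= 1 by rewrite normrN normr1.
  rewrite /sdiff.
  have E0 := Ad 0 n0; have E1 := Ad 1 n1; have EN1 := Ad (-1) nN1.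
  have V0 := vE 0 n0; have V1 := vE 1 n1; have VN1 := vE (-1) nN1.
  rewrite scale0r addr0 in E0 V0; rewrite scale1r in E1 V1; rewrite scaleN1r in EN1 VN1.
  have Z y : A y -> zero_ext A (fun x => alpha * N%:R / beta * rot_phi c x `^ beta) y =
      k * rot_phi c y `^ beta by exact: zero_ext_in.
  have sumE (a b e' a' b' e1 : R) : a = a' -> b = b' -> e' = e1 ->
      a + b - 2 * e' = a' + b' - 2 * e1 by move=> -> -> ->.
  rewrite (sumE _ _ _ _ _ _ (etrans (Z _ E1) V1) (etrans (Z _ EN1) VN1) (etrans (Z _ E0) V0)).
  apply: (cos_barrier_sdiff s0 sN k0).
    move=> i t t1; have /(rot_cube_coord cO)/(_ i) := Ac _ (Ad t t1).
    by rewrite rot_coord_line; exact: cos_gt0_pihalf.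
  move=> t t1; rewrite -[\sum_i eta i ^+ 2]/(nsq (c.2^T *m d)) (nsq_rot cO).
  rewrite ler_wpM2r ?nsq_ge0// ks.
  have := hf _ (Ad t t1); have := H2 _ (hd t r2 t1 d2) => /ltW.
  rewrite ler_distl => /andP[_ h3].
  rewrite (rot_phi_pow cO _ (Ac _ (Ad t t1))).
  rewrite (eq_bigr (fun i => ln (cos (xi i + t * eta i)))) => [h4|i _]; last by rewrite rot_coord_line.
  exact: le_trans h4 h3.
Qed.

End CosineSupersolution.
Section Assembly.
Variables (R : realType) (N : nat).
Hypothesis N2 : (2 <= N)%N.
Variables (C : set ('cV[R]_N * 'M[R]_N)) (A : set 'cV[R]_N) (f : 'cV[R]_N -> R).
Variables (alpha beta M : R).
Hypothesis CO : forall c, C c -> orthogonal_matrices c.2.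
Hypothesis oA : open A.
Hypothesis bA : bounded_set A.
Hypothesis AE : A = \bigcap_(c in C) rot_cube c.
Hypothesis cf : C0_on A f.
Hypothesis fM : forall x, A x -> f x <= M.
Hypothesis M0 : 0 <= M.
Hypothesis alpha0 : 0 < alpha.
Hypothesis beta01 : 0 < beta <= 1.
Hypothesis hf : forall x, A x -> - alpha * inf_rot_phi C x `^ beta <= f x.
Implicit Types (x y z d : 'cV[R]_N) (c : 'cV[R]_N * 'M[R]_N).

Let N0 : (0 < N)%N. Proof. exact: leq_trans N2. Qed.
Let L : R := Num.sqrt N%:R * pi.
Let B : R := alpha * N%:R / beta.
Let g : R := beta / N%:R.
Let u := envelope A f.

Let Np : 0 < N%:R :> R. Proof. by rewrite ltr0n. Qed.
Let L0 : 0 <= L. Proof. by rewrite mulr_ge0 ?sqrtr_ge0 ?pi_ge0. Qed.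
Let B0 : 0 <= B.
Proof. by have /andP[b0 _] := beta01; rewrite divr_ge0 ?(ltW b0)// mulr_ge0// ltW. Qed.
Let g01 : 0 < g <= 1.
Proof.
have /andP[b0 b1] := beta01; rewrite divr_gt0//= ler_pdivrMr// mul1r.
by rewrite (le_trans b1)// ler1n.
Qed.

Let sub_cube c : C c -> A `<=` rot_cube c.
Proof. by move=> Cc x; rewrite AE; exact. Qed.

Let not_cube x : ~ A x -> exists2 c, C c & ~ rot_cube c x.
Proof.
move=> nAx; apply: contrapT => H; apply: nAx; rewrite AE => c Cc.
by apply: contrapT => nc; apply: H; exists c.
Qed.

Let C0 : C !=set0.
Proof.
apply/set0P/eqP => CE; move: bA => [K [_ /(_ (K + 1))]]; rewrite ltrDl ltr01 => /(_ isT) H.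
pose i := Ordinal N0.
have : `|(`|K| + 2) *: unitv R i| <= K + 1 by apply: H; rewrite AE CE bigcap_set0.
rewrite leNgt => /negP; apply; apply: lt_le_trans (coord_le_norm _ i).
have p : 0 < `|K| + 2 by rewrite ltr_wpDl.
rewrite !mxE !eqxx mulr1 (gtr0_norm p).
by have := ler_norm K; lra.
Qed.

Let AL x z : A x -> A z -> enorm (x - z) <= L.
Proof.
move=> Ax Az; have [c Cc] := C0.
exact: (rot_cube_diam (CO Cc) (sub_cube Cc Ax) (sub_cube Cc Az)).
Qed.

Let convA x y t : A x -> A y -> 0 <= t <= 1 -> A (x + t *: (y - x)).
Proof.
move=> Ax Ay /andP[t0 t1]; rewrite AE => c Cc; have cO := CO Cc.
apply/(rot_cube_coord cO) => i; rewrite rot_coord_line -rot_coordB.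
rewrite [X in _ + t * X](coordB (rot_coord c y) (rot_coord c x)).
have /(rot_cube_coord cO)/(_ i)/andP[] := sub_cube Cc Ax.
have /(rot_cube_coord cO)/(_ i)/andP[] := sub_cube Cc Ay.
set a := rot_coord c y i ord0; set b := rot_coord c x i ord0 => h1 h2 h3 h4.
have [->|t00] := eqVneq t 0; first by rewrite mul0r addr0 h3 h4.
have tp : 0 < t by rewrite lt_neqAle eq_sym t00.
have t1' : 0 <= 1 - t by rewrite subr_ge0.
have k1 : 0 < t * (a + pi / 2) by rewrite mulr_gt0//; lra.
have k2 : 0 <= (1 - t) * (b + pi / 2) by rewrite mulr_ge0//; lra.
have k3 : 0 < t * (pi / 2 - a) by rewrite mulr_gt0//; lra.
have k4 : 0 <= (1 - t) * (pi / 2 - b) by rewrite mulr_ge0//; lra.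
by apply/andP; split; [move: k1 k2|move: k3 k4]; lra.
Qed.

Let hfc c x : C c -> A x -> - alpha * rot_phi c x `^ beta <= f x.
Proof.
move=> Cc Ax; apply: le_trans (hf Ax); rewrite !mulNr lerN2 ler_wpM2l ?(ltW alpha0)//.
have /andP[b0 _] := beta01.
have lb : lbound [set rot_phi c x | c in C] 0 by move=> _ [c' _ <-]; exact: rot_phi_ge0.
have i0 : 0 <= inf_rot_phi C x by apply: lb_le_inf => //; exists (rot_phi c x); exists c.
apply: ge0_ler_powR; rewrite ?nnegrE ?rot_phi_ge0 ?(ltW b0)//.
by apply: ge_inf; [exists 0|exists c].
Qed.

Let cos_in c : C c -> zero_supersol A f (zero_ext A (fun x => B * rot_phi c x `^ beta)).
Proof.
by move=> Cc; apply: cos_supersol => //; [exact: CO|exact: sub_cube|move=> x; exact: hfc].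
Qed.

Let W0 : zero_supersol A f !=set0.
Proof. by have [c Cc] := C0; eexists; exact: cos_in Cc. Qed.

Let u_ub x x0 : A x -> ~ A x0 -> u x <= B * enorm (x - x0) `^ g.
Proof.
move=> Ax nAx0; have [c Cc nc] := not_cube nAx0.
apply: le_trans (envelope_le N0 oA AL fM M0 x (cos_in Cc)) _.
rewrite zero_ext_in// ler_wpM2l// rot_phi_pow_le//; [exact: CO| |exact: sub_cube].
by have /andP[/ltW] := beta01.
Qed.

Let u_continuous : continuous u.
Proof. exact: (envelope_continuous N0 oA AL fM M0 L0 W0 convA B0 g01 u_ub). Qed.

Let uW : zero_supersol A f u.
Proof. exact: (envelope_supersol N0 oA AL fM M0 W0). Qed.

Let boundary_out x : boundary A x -> ~ A x.
Proof. by rewrite /boundary (interior_id A).1// => -[]. Qed.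

Lemma envelope_dirichlet : dirichlet_solution A f u.
Proof.
split; first exact: continuous_subspaceT.
  split=> [x _|psi x pC Ax|psi x pC Ax].
  - exact: u_continuous.
  - move=> umax; apply: (minimal_supersol_viscosity N0 oA cf uW _ u_continuous pC Ax umax).
    by move=> w wW y; exact: (envelope_le N0 oA AL fM M0 y wW).
  - exact: (supersol_viscosity N0 oA uW.1 (cf Ax) pC Ax).
by move=> x /boundary_out; exact: uW.2.
Qed.

Lemma dirichlet_unique v : dirichlet_solution A f v -> forall x, closure A x -> v x = u x.
Proof.
move=> [cv [c0v vsub vsup] bv] x cx; have [Ax|nAx] := pselect (A x); last first.
  by rewrite uW.2// bv//; split=> //; rewrite (interior_id A).1.
apply/eqP; rewrite eq_le; apply/andP; split.
  exact: (comparison N0 oA bA cf uW u_continuous cv bv vsub Ax).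
rewrite -(zero_ext_in v Ax); apply: (envelope_le N0 oA AL fM M0).
exact: (zero_ext_supersol N0 oA cf cv bv c0v vsup).
Qed.

Definition holder_const (a b M : R) (n : nat) : R :=
  let l := Num.sqrt n%:R * pi in a * n%:R / b + M / 2 * l * l `^ (1 - b / n%:R).

Let K1 := holder_const alpha beta M N.

Let K10 : 0 <= K1.
Proof. by rewrite addr_ge0// mulr_ge0 ?powR_ge0// mulr_ge0// divr_ge0. Qed.

Let u_holder x y : enorm (x - y) <= L -> `|u x - u y| <= K1 * enorm (x - y) `^ g.
Proof.
move=> xyL; apply: le_trans (envelope_holder N0 oA AL fM M0 L0 W0 convA B0 g01 u_ub x y) _.
rewrite /K1 /holder_const -/L -/B -/g mulrDl lerD2l -[leRHS]mulrA ler_wpM2l//.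
  by rewrite mulr_ge0// divr_ge0.
have /andP[g0 g1] := g01; have e0 := enorm_ge0 (x - y).
set h := enorm (x - y) in xyL e0 *.
have [->|h0] := eqVneq h 0; first by rewrite mulr_ge0// powR_ge0.
apply: (@le_trans _ _ (h `^ (1 - g) * h `^ g)).
  by rewrite -powRD ?subrK ?powRr1// h0 implybT.
rewrite ler_wpM2r ?powR_ge0//.
have := @ge0_ler_powR R (1 - g); rewrite subr_ge0 => /(_ g1); apply; rewrite ?nnegrE//.
Qed.

Let u_bound x : `|u x| <= K1 * L `^ g.
Proof.
have [Ax|nAx] := pselect (A x); last by rewrite uW.2// normr0 mulr_ge0// powR_ge0.
have d0 : unitv R (Ordinal N0) != 0.
  apply/eqP => /colP/(_ (Ordinal N0)); rewrite !mxE !eqxx => /eqP.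
  by rewrite oner_eq0.
have [s s0 [nA sL _]] := exit_time oA Ax d0 (fun z Az => AL Az Ax).
have hE : enorm (x - (x + s *: unitv R (Ordinal N0))) = s * enorm (unitv R (Ordinal N0)).
  by rewrite opprD addrA subrr add0r enormN enormZ gtr0_norm.
have := @u_holder x (x + s *: unitv R (Ordinal N0)); rewrite hE => /(_ sL).
rewrite (uW.2 _ nA) subr0 => /le_trans; apply.
have /andP[g0 _] := g01.
rewrite ler_wpM2l//; apply: ge0_ler_powR; rewrite ?nnegrE ?(ltW g0)//.
by rewrite mulr_ge0 ?enorm_ge0// ltW.
Qed.

Let closure_diam x z : closure A x -> closure A z -> enorm (x - z) <= L.
Proof.
have cl y : closed [set z : 'cV[R]_N | nsq (z - y) <= L ^+ 2].
  rewrite (_ : [set z | _] = (fun z => nsq (z - y)) @^-1` [set t : R | t <= L ^+ 2])//.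
  by apply: preimage_closed => [t _|]; [exact: (C2g_nsq y).1|exact: closed_le].
have le y y' : enorm (y - y') <= L <-> nsq (y - y') <= L ^+ 2.
  by rewrite -sqr_enorm ler_sqr ?nnegrE ?enorm_ge0.
have sub y : (forall y', A y' -> enorm (y' - y) <= L) ->
    forall x', closure A x' -> enorm (x' - y) <= L.
  move=> Ay x' cx'; apply/le.
  have : closure A `<=` closure [set z | nsq (z - y) <= L ^+ 2].
    by apply: closureS => y' /Ay/le.
  by rewrite -((closure_id _).1 (cl y)); apply.
move=> cx cz; rewrite -opprB enormN; apply: (sub x _ z cz) => y Ay.
by rewrite -opprB enormN; apply: (sub y _ x cx) => y' Ay'; exact: AL.
Qed.

Lemma envelope_holder_norm :
  (holder_norm g (closure A) u <= (K1 * L `^ g + K1)%:E)%E.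
Proof.
rewrite EFinD; apply: leeD.
  by apply: ge_ereal_sup => _ [x _ <-]; rewrite lee_fin u_bound.
apply: ge_ereal_sup => _ [[x y] /= [cx cy xy] <-]; rewrite lee_fin.
have h0 : 0 < enorm (x - y).
  by apply: enorm_gt0; rewrite subr_eq0; apply/eqP.
by rewrite ler_pdivrMr ?powR_gt0// u_holder// closure_diam.
Qed.

End Assembly.

Theorem theorem5 (R : realType) :
  exists K : R -> R -> nat -> R -> R -> R,
  forall (N : nat) (hN : (2 <= N)%N)
    (Y : set 'cV[R]_N) (C : set ('cV[R]_N * 'M[R]_N))
    (hC : C `<=` Y `*` @orthogonal_matrices R N)
    (Omega : set 'cV[R]_N)
    (Omega_domain : is_domain Omega)
    (Omega_bounded : bounded_set Omega)
    (Omega_convex : convex_set (Omega : set (convex_lmodType 'cV[R]_N)))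
    (Omega_eq : Omega = \bigcap_(c in C) rot_cube c)
    (f : 'cV[R]_N -> R)
    (f_cont : {within Omega, continuous f})
    (f_bounded : [bounded f x | x in Omega])
    (alpha beta : R) (halpha : 0 < alpha) (hbeta : 0 < beta <= 1)
    (hf : forall x, Omega x -> - alpha * inf_rot_phi C x `^ beta <= f x),
  exists u : 'cV[R]_N -> R,
    [/\ dirichlet_solution Omega f u,
        (forall v, dirichlet_solution Omega f v ->
           forall x, closure Omega x -> v x = u x),
        holder_space (beta / N%:R) (closure Omega) u &
        (holder_norm (beta / N%:R) (closure Omega) u <=
           (K alpha beta N (fine (sup_norm Omega u))
                           (fine (sup_norm Omega f)))%:E)%E].
Proof.
exists (fun a b n _ M => holder_const a b M n * (Num.sqrt n%:R * pi) `^ (b / n%:R)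
  + holder_const a b M n).
move=> N hN Y C hC A [A0 oA _] bA _ AE f fc fb alpha beta a0 b01 hf.
set M := fine (sup_norm A f).
have fM x : A x -> `|f x| <= M.
  move=> Ax; have /pinfty_ex_gt0 [K K0 HK] := fb.
  have le : (`|f x|%:E <= sup_norm A f)%E by apply: ereal_sup_ubound; exists x.
  have ge : (sup_norm A f <= K%:E)%E.
    by apply: ge_ereal_sup => _ [y Ay <-]; rewrite lee_fin; exact: HK.
  rewrite -lee_fin fineK// fin_numE.
  by apply/andP; split; apply/eqP => E; [move: le|move: ge]; rewrite E.
have M0 : 0 <= M by have [x Ax] := A0; exact: le_trans (normr_ge0 _) (fM x Ax).
have fM' x : A x -> f x <= M by move=> /fM; exact/le_trans/ler_norm.
have cf : C0_on A f.
  by move=> x Ax; move: fc; rewrite continuous_open_subspace// => /(_ x); apply; rewrite inE.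
have CO c : C c -> orthogonal_matrices c.2 by move=> /hC [].
have HN := envelope_holder_norm hN CO oA bA AE cf fM' M0 a0 b01 hf.
exists (envelope A f); split=> //.
- exact: (envelope_dirichlet hN CO oA bA AE cf fM' M0 a0 b01 hf).
- exact: (dirichlet_unique hN CO oA bA AE cf fM' M0 a0 b01 hf).
- exact: le_lt_trans HN (ltry _).
Qed.
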